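(* Let $X$ be an infinite-dimensional separable Hilbert space and let $M>1$. Let $\mathcal{L}(X)$ be the set of all bounded linear operators from $X$ to itself and $\mathcal{L}_M(X)=\{T\in\mathcal{L}(X):\Vert T\Vert\le M\}$. Then the set of all hypercyclic operators $T\in\mathcal{L}_M(X)$ having a residual subset of absolutely mean irregular vectors is a dense $G_\delta$ subset of $\mathcal{L}_M(X)$ with respect to the strong$^*$ operator topology.
   Context: $T^n$ denotes the $n$-fold composition of $T$, and $T^*$ the adjoint of $T$. A vector $x\in X$ is a hypercyclic vector for $T$ if its orbit $\{T^nx : n\ge 0\}$ is dense in $X$; $T$ is hypercyclic if it has some hypercyclic vector. A vector $x\in X$ is absolutely mean irregular for $T$ if $\liminf_{n\to\infty}\frac1n\sum_{i=1}^n\Vert T^ix\Vert=0$ and $\limsup_{n\to\infty}\frac1n\sum_{i=1}^n\Vert T^ix\Vert=\infty$. A subset of $X$ is residual if it contains a dense $G_\delta$ subset of $X$. The strong$^*$ operator topology on $\mathcal{L}(X)$ is the topology in which each $T\in\mathcal{L}(X)$ has a neighborhood basis consisting of the sets $\{S\in\mathcal{L}(X): \Vert Sx_i-Tx_i\Vert<\varepsilon,\ \Vert S^*x_i-T^*x_i\Vert<\varepsilon,\ i=1,\dots,n\}$, where $x_1,\dots,x_n\in X$ and $\varepsilon>0$; $\mathcal{L}_M(X)$ carries the subspace topology. *)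

(* Defs.v *)
From HB Require Import structures.
From mathcomp Require Import all_boot all_order all_algebra.
From mathcomp Require Import complex.
From mathcomp Require Import all_classical all_reals all_analysis.
From mathcomp Require Import borel_hierarchy.

Set Implicit Arguments.
Unset Strict Implicit.
Unset Printing Implicit Defensive.

Import Order.TTheory GRing.Theory Num.Theory.
Import numFieldNormedType.Exports.

Local Open Scope classical_set_scope.
Local Open Scope ring_scope.
Local Open Scope complex_scope.

(* A Hilbert space is real or complex.  In the library the norm of a normed
   module over K takes its values in K, hence [scalar_re] to read it in R. *)
Variant scalars := RealScalars | ComplexScalars.

Definition scalar_field (R : realType) (k : scalars) : numFieldType :=
  match k with RealScalars => R | ComplexScalars => R[i] end.

Definition scalar_conj (R : realType) (k : scalars) :
    scalar_field R k -> scalar_field R k :=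
  match k with
  | RealScalars => fun a : R => a
  | ComplexScalars => fun a : R[i] => a^*
  end.

Definition scalar_re (R : realType) (k : scalars) : scalar_field R k -> R :=
  match k with
  | RealScalars => fun a : R => a
  | ComplexScalars => fun a : R[i] => complex.Re a
  end.

HB.mixin Record isHilbert (R : realType) (k : scalars) (X : Type)
    of CompleteNormedModule (scalar_field R k) X := {
  hdot : {dot X for @scalar_conj R k};
  hdot_normE : forall x : X, `|x| ^+ 2 = hdot x x
}.

#[short(type="hilbertType")]
HB.structure Definition Hilbert (R : realType) (k : scalars) :=
  {X of isHilbert R k X & CompleteNormedModule (scalar_field R k) X}.

Section hilbert_space.
Context {R : realType} {k : scalars} (X : hilbertType R k).

Definition rnorm (x : X) : R := scalar_re `|x|.

Definition infinite_dimensional : Prop :=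
  ~ exists (n : nat) (e : 'I_n -> X), forall x : X,
      exists c : 'I_n -> scalar_field R k, x = \sum_(i < n) c i *: e i.

Definition separable : Prop := exists D : set X, countable D /\ dense D.

Record bounded_operator := BoundedOperator {
  bounded_operator_fun :> {linear X -> X};
  bounded_operatorP : exists C : R, forall x : X,
    rnorm (bounded_operator_fun x) <= C * rnorm x
}.

HB.instance Definition _ := gen_eqMixin bounded_operator.
HB.instance Definition _ := gen_choiceMixin bounded_operator.

Definition opnorm (T : bounded_operator) : R :=
  sup [set rnorm (T x) | x in [set x : X | rnorm x <= 1]].

(* By the Riesz representation theorem exactly one S satisfies the condition,
   so the default value T is never returned. *)
Definition adjoint (T : bounded_operator) : bounded_operator :=
  xget T [set S : bounded_operator |
           forall x y : X, hdot (T x) y = hdot x (S y)].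

Definition hypercyclic_vector (T : X -> X) (x : X) : Prop :=
  dense (range (fun n : nat => iter n T x)).

Definition hypercyclic (T : X -> X) : Prop :=
  exists x : X, hypercyclic_vector T x.

(* The value at n = 0 is irrelevant below. *)
Definition orbit_mean (T : X -> X) (x : X) (n : nat) : R :=
  n%:R^-1 * \sum_(1 <= i < n.+1) rnorm (iter i T x).

Definition absolutely_mean_irregular (T : X -> X) (x : X) : Prop :=
  limn_einf (EFin \o orbit_mean T x) = 0%E /\
  limn_esup (EFin \o orbit_mean T x) = +oo%E.

Definition sstar_basic (T : bounded_operator) (s : seq X) (e : R) :
    set bounded_operator :=
  [set S : bounded_operator | forall x : X, x \in s ->
     rnorm (S x - T x) < e /\ rnorm (adjoint S x - adjoint T x) < e].

Definition sstar_nbhs (T : bounded_operator) : set_system bounded_operator :=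
  [set U | exists (s : seq X) (e : R), 0 < e /\ sstar_basic T s e `<=` U].

Lemma scalar_reD (a b : scalar_field R k) :
  scalar_re (a + b) = scalar_re a + scalar_re b.
Proof. by case: k a b => //= -[? ?] [? ?]. Qed.

Lemma scalar_re_le (a b : scalar_field R k) :
  a <= b -> scalar_re a <= scalar_re b.
Proof. by case: k a b => //= -[? ?] [? ?]; rewrite lecE => /andP[]. Qed.

Lemma scalar_re0 : scalar_re (0 : scalar_field R k) = 0.
Proof. by case: k. Qed.

Lemma rnorm_triangle (x y z : X) :
  rnorm (x - z) <= rnorm (x - y) + rnorm (y - z).
Proof. by rewrite /rnorm -scalar_reD; exact/scalar_re_le/ler_distD. Qed.

Lemma rnorm_subrr (x : X) : rnorm (x - x) = 0.
Proof. by rewrite subrr /rnorm normr0 scalar_re0. Qed.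

Lemma sstar_basic_refl T s e : 0 < e -> sstar_basic T s e T.
Proof. by move=> e0 x _; rewrite !rnorm_subrr. Qed.

Lemma sstar_basic_shrink T s e S : 0 < e -> sstar_basic T s e S ->
  exists2 d, 0 < d & sstar_basic S s d `<=` sstar_basic T s e.
Proof.
move=> e0; elim: s => [|a s IHs] TS.
  by exists 1 => // S' _ x; rewrite in_nil.
have [|d d0 Hd] := IHs; first by move=> x xs; apply: TS; rewrite inE xs orbT.
have [Ha Ha'] := TS a (mem_head a s).
exists (Num.min d (Num.min (e - rnorm (S a - T a))
                     (e - rnorm (adjoint S a - adjoint T a)))).
  by rewrite !lt_min d0 !subr_gt0 Ha Ha'.
move=> S' SS' x; rewrite inE => /predU1P[->|xs].
  have := SS' a (mem_head a s).
  rewrite !lt_min => -[/and3P[_ h _] /and3P[_ _ h']]; split.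
    by apply: le_lt_trans (rnorm_triangle _ (S a) _) _; rewrite -ltrBrDr.
  by apply: le_lt_trans (rnorm_triangle _ (adjoint S a) _) _; rewrite -ltrBrDr.
apply: Hd xs => y ys; have := SS' y.
by rewrite inE ys orbT !lt_min => /(_ isT)[/and3P[-> _ _] /and3P[-> _ _]].
Qed.

HB.instance Definition _ := hasNbhs.Build bounded_operator sstar_nbhs.

Fact sstar_nbhs_filter (T : bounded_operator) : ProperFilter (nbhs T).
Proof.
split=> [[s [e [e0]]]|]; first by move=> /(_ T); apply; exact: sstar_basic_refl.
split.
- by exists [::], 1; split.
- move=> U V [s [e [e0 sU]]] [s' [e' [e'0 sV]]].
  exists (s ++ s'), (Num.min e e'); split; first by rewrite lt_min e0.
  move=> S TS; split; [apply: sU | apply: sV] => x xs;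
    have := TS x; rewrite mem_cat xs ?orbT => /(_ isT);
    by rewrite !lt_min => -[/andP[? ?] /andP[? ?]].
- move=> U V UV [s [e [e0 sU]]]; exists s, e; split=> //.
  exact: subset_trans UV.
Qed.

Fact sstar_nbhs_singleton (T : bounded_operator) (U : set bounded_operator) :
  nbhs T U -> U T.
Proof. by move=> [s [e [e0]]]; apply; exact: sstar_basic_refl. Qed.

Fact sstar_nbhs_nbhs (T : bounded_operator) (U : set bounded_operator) :
  nbhs T U -> nbhs T (nbhs^~ U).
Proof.
move=> [s [e [e0 sU]]]; exists s, e; split=> // S TS.
have [d d0 Sd] := sstar_basic_shrink e0 TS.
by exists s, d; split=> //; exact: subset_trans sU.
Qed.

(* The topology of [bounded_operator] is the strong* operator topology. *)
HB.instance Definition _ := Nbhs_isNbhsTopological.Build bounded_operator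
  sstar_nbhs_filter sstar_nbhs_singleton sstar_nbhs_nbhs.

(* As a type, [operator_ball M] carries the subspace topology. *)
Definition operator_ball (M : R) : set bounded_operator :=
  [set T | opnorm T <= M].

End hilbert_space.

Arguments operator_ball {R k} X M.
Arguments infinite_dimensional {R k} X.
Arguments separable {R k} X.

Definition residual (T : topologicalType) (A : set T) : Prop :=
  exists G : set T, [/\ Gdelta G, dense G & G `<=` A].

(* Main.v *)
(** Proof idea.  By Baire's theorem on X, an operator T is hypercyclic iff it is
    topologically transitive, and has a residual set of absolutely mean
    irregular vectors iff every basic open set U_i contains, for each l, a
    vector with some mean of index >= l below 1/(l+1) and a vector with some
    mean of index >= l above l.  On the ball of radius M every T |-> T^n x is
    continuous, so these are countably many relatively open conditions on T.

    For density, let P be the projection onto the first N vectors of an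
    orthonormal basis, V the isometry e_i |-> e_(i+N), B := V^* and Q := 1 - P.
    The operator S := c PTP + d PB + w QB with c < 1 close to 1, d > 0 small
    and max(1, cM) < w <= M - d has norm at most M, and S, S^* are strongly
    close to T, T^* for N large.  It has the right inverse
    F := V (d^-1 P + w^-1 Q), with |F^(n+1) y| <= L w^-n |y| because PV = 0.
    If B^m x = 0, then S^n x lies in the range of P for n >= m and so grows at
    most like (cM)^n; hence x - F^n S^n x is a small perturbation of x killed
    by S^n.  Thus vectors with finite orbit are dense, and adding F^n y to them
    yields transitivity and arbitrarily large means. *)
Require Import Defs.
From HB Require Import structures.
From mathcomp Require Import all_boot all_order all_algebra.
From mathcomp Require Import complex zify ring lra.
From mathcomp Require Import all_classical all_reals all_analysis.
From mathcomp Require Import borel_hierarchy.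
Import Order.TTheory GRing.Theory Num.Theory.
Import numFieldNormedType.Exports.
Local Open Scope classical_set_scope.
Local Open Scope ring_scope.

Set Implicit Arguments.
Unset Strict Implicit.
Unset Printing Implicit Defensive.

(** * Scalars *)

Section scalars.
Context {R : realType} {k : scalars}.
Local Notation K := (scalar_field R k).
Local Notation conj := (@scalar_conj R k).
Implicit Types (a b : R) (z w : K).

(** The library norm is [K]-valued, so real estimates are transported through this embedding, which
    reflects the order and has [scalar_re] as left inverse. *)
Definition of_real : R -> K :=
  match k return R -> scalar_field R k with
  | RealScalars => fun a : R => a
  | ComplexScalars => fun a : R => (a%:C)%C
  end.

Definition rabs (z : K) : R := scalar_re `|z|.

Lemma of_realD a b : of_real (a + b) = of_real a + of_real b.
Proof. by rewrite /of_real; case: k => //=; rewrite rmorphD. Qed.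

Lemma of_realN a : of_real (- a) = - of_real a.
Proof. by rewrite /of_real; case: k => //=; rewrite rmorphN. Qed.

Lemma of_realM a b : of_real (a * b) = of_real a * of_real b.
Proof. by rewrite /of_real; case: k => //=; rewrite rmorphM. Qed.

Lemma of_real0 : of_real 0 = 0. Proof. by rewrite /of_real; case: k. Qed.

Lemma of_real1 : of_real 1 = 1. Proof. by rewrite /of_real; case: k. Qed.

Lemma of_realK a : scalar_re (of_real a) = a.
Proof. by rewrite /of_real; case: k. Qed.

Lemma of_real_le a b : (of_real a <= of_real b) = (a <= b).
Proof. by rewrite /of_real; case: k => //=; rewrite lecR. Qed.

Lemma of_real_lt a b : (of_real a < of_real b) = (a < b).
Proof. by rewrite /of_real; case: k => //=; rewrite ltcR. Qed.

(** Complex numbers are comparable only when their imaginary parts agree, so a nonnegative scalar is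
    real. *)
Lemma ge0_of_real z : 0 <= z -> of_real (scalar_re z) = z.
Proof.
rewrite /of_real /scalar_re; case: k z => //= -[x y].
by rewrite lecE => /andP[/eqP /= ->].
Qed.

Lemma of_real_rabs z : of_real (rabs z) = `|z|.
Proof. exact: ge0_of_real. Qed.

Lemma rabs_of_real a : rabs (of_real a) = `|a|.
Proof.
rewrite /rabs /of_real; case: k => //=.
by rewrite [LHS](congr1 (@complex.Re R) (normc_def (a%:C)%C)) /= expr0n addr0
  sqrtr_sqr.
Qed.

Lemma rabs_ge0 z : 0 <= rabs z.
Proof. by rewrite -of_real_le of_real0 of_real_rabs. Qed.

Lemma rabs0 : rabs 0 = 0.
Proof. by rewrite -of_real0 rabs_of_real normr0. Qed.

Lemma rabs1 : rabs 1 = 1.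
Proof. by rewrite -of_real1 rabs_of_real normr1. Qed.

Lemma of_real_inj : injective of_real.
Proof. by move=> a b /(congr1 (@scalar_re R k)); rewrite !of_realK. Qed.

Lemma rabsM z w : rabs (z * w) = rabs z * rabs w.
Proof. by apply: of_real_inj; rewrite of_realM !of_real_rabs normrM. Qed.

Lemma scalar_conj0 : conj 0 = 0.
Proof. by rewrite /scalar_conj; case: k => //=; exact: conjc0. Qed.

Lemma scalar_conjK : involutive conj.
Proof. by rewrite /scalar_conj; case: k => //= z; exact: conjcK. Qed.

Lemma scalar_conj_of_real a : conj (of_real a) = of_real a.
Proof. by rewrite /scalar_conj /of_real; case: k => //=; exact: conjc_real. Qed.

Lemma mulr_conj z : z * conj z = of_real (rabs z ^+ 2).
Proof.
rewrite expr2 of_realM !of_real_rabs -expr2.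
rewrite /scalar_conj; case: k z => //= z; first
  by rewrite real_normK ?num_real // expr2.
exact/esym/sqr_normc.
Qed.

End scalars.

(** * Inner product *)

Section inner_product.
Context {R : realType} {k : scalars} {X : hilbertType R k}.
Local Notation K := (scalar_field R k).
Local Notation conj := (@scalar_conj R k).
Implicit Types (x y z : X) (a : K).

Lemma of_real_rnorm x : of_real (rnorm x) = `|x| :> K.
Proof. exact: ge0_of_real. Qed.

Lemma rnorm_ge0 x : 0 <= rnorm x.
Proof. by rewrite -(@of_real_le _ k) of_real0 of_real_rnorm. Qed.

Lemma rnormZ a x : rnorm (a *: x) = rabs a * rnorm x.
Proof.
by apply: (@of_real_inj _ k);
  rewrite of_realM of_real_rnorm normrZ of_real_rabs of_real_rnorm.
Qed.

Lemma rnorm0 : rnorm (0 : X) = 0.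
Proof. by rewrite -(scale0r 0) rnormZ rabs0 mul0r. Qed.

Lemma rnorm_eq0 x : (rnorm x == 0) = (x == 0).
Proof.
apply/eqP/eqP => [x0|->]; last exact: rnorm0.
by apply/normr0_eq0; rewrite -of_real_rnorm x0 of_real0.
Qed.

Lemma rnorm_gt0 x : (0 < rnorm x) = (x != 0).
Proof. by rewrite lt_def rnorm_eq0 rnorm_ge0 andbT. Qed.

Lemma rnormN x : rnorm (- x) = rnorm x.
Proof. by rewrite /rnorm normrN. Qed.

Lemma rnormB x y : rnorm (x - y) = rnorm (y - x).
Proof. by rewrite -rnormN opprB. Qed.

Lemma rnormD x y : rnorm (x + y) <= rnorm x + rnorm y.
Proof.
by have := rnorm_triangle x 0 (- y); rewrite opprK subr0 add0r.
Qed.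

Lemma rnormZr (c : R) x : 0 <= c -> rnorm ((of_real c : K) *: x) = c * rnorm x.
Proof. by move=> c0; rewrite rnormZ rabs_of_real ger0_norm. Qed.

Lemma hdotDl x y z : hdot (x + y) z = hdot x z + hdot y z.
Proof. exact: linearDl. Qed.

Lemma hdotDr x y z : hdot x (y + z) = hdot x y + hdot x z.
Proof. exact: linearDr. Qed.

Lemma hdotZl a x y : hdot (a *: x) y = a * hdot x y.
Proof. exact: linearZl_LR. Qed.

Lemma hdotZr a x y : hdot x (a *: y) = conj a * hdot x y.
Proof. exact: linearZr_LR. Qed.

Lemma hdotC x y : hdot x y = conj (hdot y x).
Proof. by rewrite hermitian_subproof expr0 mul1r. Qed.

Lemma hdot0l x : hdot 0 x = 0. Proof. exact: linear0l. Qed.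

Lemma hdot0r x : hdot x 0 = 0. Proof. exact: linear0r. Qed.

Lemma hdotNl x y : hdot (- x) y = - hdot x y. Proof. exact: linearNl. Qed.

Lemma hdotNr x y : hdot x (- y) = - hdot x y. Proof. exact: linearNr. Qed.

Lemma hdotBl x y z : hdot (x - y) z = hdot x z - hdot y z.
Proof. by rewrite hdotDl hdotNl. Qed.

Lemma hdotBr x y z : hdot x (y - z) = hdot x y - hdot x z.
Proof. by rewrite hdotDr hdotNr. Qed.

Lemma hdotxx x : hdot x x = of_real (rnorm x ^+ 2) :> K.
Proof. by rewrite -hdot_normE [in RHS]expr2 of_realM of_real_rnorm. Qed.

Lemma hdotC0 x y : hdot x y = 0 -> hdot y x = 0.
Proof. by rewrite hdotC => xy0;
  rewrite -[LHS]scalar_conjK xy0 scalar_conj0. Qed.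

Lemma pythagoras x y :
  hdot x y = 0 -> rnorm (x + y) ^+ 2 = rnorm x ^+ 2 + rnorm y ^+ 2.
Proof.
move=> xy0; apply: (@of_real_inj _ k).
by rewrite of_realD -!hdotxx hdotDl !hdotDr xy0 (hdotC0 xy0) addr0 add0r.
Qed.

(** With [a *: y] the orthogonal projection of [x] on the line of [y], Pythagoras gives
    [rabs a * rnorm y <= rnorm x]; multiply by [rnorm y]. *)
Lemma cauchy_schwarz x y : rabs (hdot x y) <= rnorm x * rnorm y.
Proof.
have [->|y0] := eqVneq y 0; first by rewrite hdot0r rabs0 rnorm0 mulr0.
have ny : 0 < rnorm y by rewrite rnorm_gt0.
pose a := hdot x y / hdot y y.
have yy0 : hdot y y != 0.
  by rewrite hdotxx -(of_real0 : _ = 0 :> K) (inj_eq (@of_real_inj _ _))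
    sqrf_eq0 rnorm_eq0.
have o : hdot (a *: y) (x - a *: y) = 0.
  by apply: hdotC0; rewrite hdotZr hdotBl hdotZl divfK // subrr mulr0.
have := pythagoras o; rewrite addrC subrK rnormZ => e.
have ay : rabs a * rnorm y ^+ 2 = rabs (hdot x y).
  have <- : rabs (hdot y y) = rnorm y ^+ 2
    by rewrite hdotxx rabs_of_real ger0_norm ?sqr_ge0.
  by rewrite -rabsM divfK.
have : rabs a * rnorm y <= rnorm x.
  by rewrite -ler_sqr ?nnegrE ?mulr_ge0 ?rnorm_ge0 ?rabs_ge0 // e lerDl sqr_ge0.
by move=> h; rewrite -ay expr2 mulrA ler_wpM2r // rnorm_ge0.
Qed.

(** Passage from library balls, whose radii lie in [K], to balls of real radius. *)
Lemma nbhs_rnormP x (A : set X) :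
  nbhs x A <-> exists2 e : R, 0 < e & forall y, rnorm (y - x) < e -> A y.
Proof.
split.
  move=> /nbhs_ballP[e /= e0 eA]; exists (scalar_re e).
    by rewrite -(@of_real_lt _ k) of_real0 ge0_of_real // ltW.
  move=> y; rewrite -(@of_real_lt _ k) of_real_rnorm ge0_of_real ?(ltW e0) // =>
    h.
  by apply: eA; rewrite -ball_normE /ball_/= distrC.
move=> [e e0 eA]; apply/nbhs_ballP; exists (of_real e) => /=.
  by rewrite -(of_real0 : _ = 0 :> K) of_real_lt.
move=> y; rewrite -ball_normE /ball_/= distrC -of_real_rnorm of_real_lt.
exact: eA.
Qed.

Lemma rnorm_complete (u : nat -> X) :
  (forall e : R, 0 < e -> exists N, forall m n, (N <= m)%N -> (N <= n)%N ->
     rnorm (u m - u n) < e) ->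
  exists l, forall e : R, 0 < e -> exists N, forall n, (N <= n)%N ->
    rnorm (u n - l) < e.
Proof.
move=> cu; have /cauchy_cvg ul : cauchy (u @ \oo).
  apply: cauchy_exP => e e0.
  have [|N hN] := cu (scalar_re e).
    by rewrite -(@of_real_lt _ k) of_real0 ge0_of_real // ltW.
  exists (u N), N => // n /= Nn; rewrite -ball_normE /ball_/=.
  by rewrite -of_real_rnorm -(ge0_of_real (ltW e0)) of_real_lt hN.
exists (lim (u @ \oo)) => e e0.
have /ul : nbhs (lim (u @ \oo)) [set y | rnorm (y - lim (u @ \oo)) < e].
  by apply/nbhs_rnormP; exists e.
by move=> [N _ hN]; exists N => n Nn; exact: hN.
Qed.

End inner_product.

(** * Orthonormal bases *)

Section orthonormal.
Context {R : realType} {k : scalars} {X : hilbertType R k}.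
Local Notation K := (scalar_field R k).
Implicit Types (x y z : X) (a : K).

Lemma rnorm_unit x : hdot x x = 1 -> rnorm x = 1.
Proof.
rewrite hdotxx -(of_real1 : _ = 1 :> K) => /of_real_inj /eqP.
by rewrite sqrf_eq1 => /orP[/eqP //|/eqP x1]; have := rnorm_ge0 x; rewrite x1;
  lra.
Qed.

Definition orthonormal_upto (e : nat -> X) (n : nat) :=
  forall i j, (i < n)%N -> (j < n)%N -> hdot (e i) (e j) = (i == j)%:R.

(* This is the orthogonal projection onto the span of the first [n] vectors
   only when [orthonormal_upto e n] holds. *)
Definition oproj (e : nat -> X) (n : nat) x := \sum_(i < n) hdot x (e i) *: e i.

Lemma oprojS e n x : oproj e n.+1 x = oproj e n x + hdot x (e n) *: e n.
Proof. by rewrite /oproj big_ord_recr. Qed.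

(** Every rank-one map [x |-> hdot x (e i) *: e i] is self-adjoint, hence so is their sum. *)
Lemma hdot_oproj e n x y : hdot (oproj e n x) y = hdot x (oproj e n y).
Proof.
elim: n => [|n IH]; first by rewrite /oproj !big_ord0 hdot0l hdot0r.
rewrite !oprojS hdotDl hdotDr IH hdotZl hdotZr; congr (_ + _).
by rewrite [hdot (e n) y]hdotC mulrC.
Qed.

Lemma oproj_linear e n : linear (oproj e n).
Proof.
move=> a x y; rewrite /oproj scaler_sumr -big_split; apply: eq_bigr => i _ /=.
by rewrite hdotDl hdotZl scalerDl scalerA.
Qed.

Lemma oprojB e n x y : oproj e n (x - y) = oproj e n x - oproj e n y.
Proof. by rewrite addrC -scaleN1r oproj_linear scaleN1r addrC. Qed.

Lemma oproj0 e n : oproj e n 0 = 0.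
Proof. by rewrite /oproj big1 // => i _; rewrite hdot0l scale0r. Qed.

Lemma oprojZ e n a x : oproj e n (a *: x) = a *: oproj e n x.
Proof. by have := oproj_linear e n a x 0; rewrite oproj0 !addr0. Qed.

Lemma oprojD e n x y : oproj e n (x + y) = oproj e n x + oproj e n y.
Proof. by have := oproj_linear e n 1 x y; rewrite !scale1r. Qed.

Section finite.
Variables (e : nat -> X) (n : nat).
Hypothesis oe : orthonormal_upto e n.

Lemma hdot_sum_on (c : nat -> K) m j : (m <= n)%N -> (j < n)%N ->
  hdot (\sum_(i < m) c i *: e i) (e j) = if (j < m)%N then c j else 0.
Proof.
move=> mn jn; elim: m mn => [|m IH] mn; first by rewrite big_ord0 hdot0l.
rewrite big_ord_recr /= hdotDl hdotZl IH; last exact: ltnW.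
rewrite oe // ltnS [(j <= m)%N]leq_eqVlt [m == j]eq_sym.
have [->|_] := eqVneq j m; first by rewrite ltnn add0r mulr1.
by rewrite mulr0 addr0.
Qed.

Lemma rnorm_sum_on (c : nat -> K) m : (m <= n)%N ->
  rnorm (\sum_(i < m) c i *: e i) ^+ 2 = \sum_(i < m) rabs (c i) ^+ 2.
Proof.
elim: m => [|m IH] mn; first by rewrite !big_ord0 rnorm0 expr0n.
rewrite !big_ord_recr /= pythagoras; last first.
  by rewrite hdotZr hdot_sum_on ?ltnn ?mulr0 // ltnW.
rewrite IH ?(ltnW mn) // rnormZ rnorm_unit ?mulr1 //.
by rewrite oe // eqxx.
Qed.

Lemma hdot_oproj_basis x j : (j < n)%N ->
  hdot (oproj e n x) (e j) = hdot x (e j).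
Proof. by move=> jn; rewrite (@hdot_sum_on (fun i => hdot x (e i))) ?jn. Qed.

Lemma oproj_idem x : oproj e n (oproj e n x) = oproj e n x.
Proof. by apply: eq_bigr => i _; rewrite hdot_oproj_basis. Qed.

Lemma hdot_oproj_compl x y : hdot (oproj e n x) (y - oproj e n y) = 0.
Proof. by rewrite hdotBr -!hdot_oproj oproj_idem subrr. Qed.

Lemma oproj_pythagoras x :
  rnorm x ^+ 2 = rnorm (oproj e n x) ^+ 2 + rnorm (x - oproj e n x) ^+ 2.
Proof. by rewrite -pythagoras ?hdot_oproj_compl // addrC subrK. Qed.

Lemma bessel x : \sum_(i < n) rabs (hdot x (e i)) ^+ 2 <= rnorm x ^+ 2.
Proof.
rewrite -(@rnorm_sum_on (fun i => hdot x (e i))) // -/(oproj e n x).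
by rewrite [leRHS]oproj_pythagoras lerDl sqr_ge0.
Qed.

Lemma rnorm_oproj x : rnorm (oproj e n x) <= rnorm x.
Proof.
rewrite -ler_sqr ?nnegrE ?rnorm_ge0 //.
by rewrite [leRHS]oproj_pythagoras lerDl sqr_ge0.
Qed.

Lemma rnorm_oproj_compl x : rnorm (x - oproj e n x) <= rnorm x.
Proof.
rewrite -ler_sqr ?nnegrE ?rnorm_ge0 //.
by rewrite [leRHS]oproj_pythagoras lerDr sqr_ge0.
Qed.

Lemma normalization (r : X) : r != 0 ->
  exists2 u, hdot u u = 1 & exists2 a, u = a *: r & r = of_real (rnorm r) *: u.
Proof.
move=> r0; have nr : rnorm r != 0 by rewrite rnorm_eq0.
have nrK : of_real (rnorm r) != 0 :> K.
  by rewrite -(of_real0 : _ = 0 :> K) (inj_eq (@of_real_inj _ _)).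
exists ((of_real (rnorm r))^-1 *: r); last first.
  by exists (of_real (rnorm r))^-1 => //; rewrite scalerA divff // scale1r.
rewrite hdotxx rnormZ; apply/eqP;
  rewrite -(of_real1 : _ = 1 :> K) (inj_eq (@of_real_inj _ _)).
apply/eqP; rewrite -[X in (_ * X) ^+ 2](ger0_norm (rnorm_ge0 r))
  -(@rabs_of_real _ k) -rabsM.
by rewrite mulVf // rabs1 expr1n.
Qed.

(** The new vector is the normalized component of [v] orthogonal to the first [n] vectors. If that
    component vanishes, infinite dimension provides a vector outside their span, and [a] is 0. *)
Lemma orthonormal_extension (hdim : infinite_dimensional X) v :
  exists u, [/\ hdot u u = 1, forall i, (i < n)%N -> hdot u (e i) = 0 &
    exists a, v = oproj e n v + a *: u].
Proof.
have key w : w - oproj e n w != 0 -> exists u, [/\ hdot u u = 1,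
    forall i, (i < n)%N -> hdot u (e i) = 0 &
    exists a, w - oproj e n w = a *: u].
  move=> /normalization[u u1 [a ua ru]]; exists u; split=> //; last
    by exists (of_real (rnorm (w - oproj e n w))).
  by move=> i ni; rewrite ua hdotZl hdotBl hdot_oproj_basis // subrr mulr0.
have [v0|/key[u [u1 ue [a va]]]] := eqVneq (v - oproj e n v) 0; last first.
  by exists u; split=> //; exists a; rewrite -va addrC subrK.
have [[w /key[u [u1 ue _]]]|h] := pselect (exists w, w - oproj e n w != 0).
  exists u; split=> //; exists 0; rewrite scale0r addr0.
  by apply/eqP; rewrite -subr_eq0 v0.
exfalso; apply: hdim; exists n, (fun i : 'I_n => e i) => x.
exists (fun i : 'I_n => hdot x (e i)); apply/eqP; rewrite -subr_eq0.
by apply/negPn/negP => x0; apply: h; exists x.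
Qed.

End finite.

Definition orthonormal_basis (e : nat -> X) :=
  (forall n, orthonormal_upto e n) /\
  (forall x (eps : R), 0 < eps ->
     exists N, forall n, (N <= n)%N -> rnorm (x - oproj e n x) < eps).

Lemma dense_sequence : separable X ->
  exists d : nat -> X,
    forall x (eps : R), 0 < eps -> exists n, rnorm (d n - x) < eps.
Proof.
move=> [D [/countable_injP[f injf] denD]].
(* Indices outside the image of [f] get the default vector 0, which is harmless for density. *)
exists (fun n => xget 0 [set x | D x /\ f x = n]) => x eps eps0.
have [||y [/= yx Dy]] := denD [set y : X | rnorm (y - x) < eps]°%classic.
- exists x; apply/nbhs_rnormP; exists eps => //.
- exact: open_interior.
exists (f y).
have : [set z | D z /\ f z = f y] y by [].
move=> /(xgetI 0); set z := xget _ _ => -[Dz fz].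
have -> : z = y by apply: injf; rewrite ?inE.
exact: (interior_subset yx).
Qed.

Lemma orthonormal_upto_eq (e e' : nat -> X) n :
  (forall i, (i < n)%N -> e i = e' i) ->
  orthonormal_upto e n -> orthonormal_upto e' n.
Proof. by move=> ee oe i j ni nj; rewrite -!ee ?oe. Qed.

Lemma oproj_eq (e e' : nat -> X) n x : (forall i, (i < n)%N -> e i = e' i) ->
  oproj e n x = oproj e' n x.
Proof. by move=> ee; apply: eq_bigr => i _; rewrite ee. Qed.

(** Gram-Schmidt along a dense sequence [d]. Each [d n] lies in the span of [e 0, ..., e n], so
    later projections fix it; as [1 - oproj] does not increase norms, [x] is within
    [rnorm (d n - x)] of its projections. *)
Lemma orthonormal_basis_exists : infinite_dimensional X -> separable X ->
  exists e, orthonormal_basis e.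
Proof.
move=> hdim /dense_sequence[d dd].
(* [next] receives the list built so far and the vector to absorb; its value on a list that is not
   orthonormal is arbitrary. *)
have /choice[next nextP] : forall p : seq X * X, exists u,
  orthonormal_upto (nth 0 p.1) (size p.1) ->
    [/\ hdot u u = 1, forall i, (i < size p.1)%N -> hdot u (nth 0 p.1 i) = 0 &
    exists a, p.2 = oproj (nth 0 p.1) (size p.1) p.2 + a *: u].
  move=> [s v]; have [os|nos] := pselect (orthonormal_upto (nth 0 s) (size s)).
    by have [u uP] := orthonormal_extension os hdim v; exists u.
  by exists 0.
pose gs := fix gs n : seq X :=
  if n is n'.+1 then rcons (gs n') (next (gs n', d n')) else [::].
pose e n := next (gs n, d n).
have sgs n : size (gs n) = n by elim: n => //= n IH; rewrite size_rcons IH.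
have gse n i : (i < n)%N -> nth 0 (gs n) i = e i.
  elim: n => // n IH; rewrite ltnS leq_eqVlt /= nth_rcons sgs =>
    /predU1P[->|ni].
    by rewrite ltnn eqxx.
  by rewrite ni IH.
have next_e n : orthonormal_upto e n -> [/\ hdot (e n) (e n) = 1,
    forall i, (i < n)%N -> hdot (e n) (e i) = 0 &
    exists a, d n = oproj e n (d n) + a *: e n].
  move=> oe; have [|u1 ue [a da]] := nextP (gs n, d n).
    rewrite /= sgs; apply: orthonormal_upto_eq oe => i ni; exact/esym/gse.
  rewrite /= sgs in ue da; split => //.
    by move=> i ni; rewrite -[e i](@gse n) // ue.
  by exists a; rewrite {1}da; congr (_ + _); apply: oproj_eq => i; exact: gse.
have oe n : orthonormal_upto e n.
  elim: n => // n IH i j; have [u1 ue _] := next_e n IH.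
  rewrite !ltnS leq_eqVlt => /predU1P[->|ni]; rewrite leq_eqVlt =>
    /predU1P[->|nj].
  - by rewrite u1 eqxx.
  - by rewrite ue // gtn_eqF.
  - by rewrite (hdotC0 (ue _ ni)) ltn_eqF.
  - exact: IH.
exists e; split => // x eps eps0.
have [n dnx] := dd x eps eps0.
have dn : oproj e n.+1 (d n) = d n.
  have [u1 ue [a da]] := next_e n (oe n).
  rewrite oprojS {2}da hdotDl hdotZl u1 mulr1 hdot_oproj.
  have -> : oproj e n (e n) = 0.
    by rewrite /oproj big1 // => i _; rewrite ue ?scale0r.
  by rewrite hdot0r add0r -da.
exists n.+1 => m nm.
(* The coefficients of [d n] at indices beyond [n] vanish, since [d n] is a combination of the first
   [n.+1] vectors. *)
have dm : oproj e m (d n) = d n.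
  elim: m nm => // m IH; rewrite leq_eqVlt => /predU1P[<- //|nm].
  rewrite oprojS IH // -{2}dn
    (@hdot_sum_on e m.+1 (oe _) (fun i => hdot (d n) (e i))) //; last exact:
      leqW.
  by rewrite ltnNge -ltnS nm scale0r addr0.
apply: le_lt_trans dnx; rewrite rnormB.
have := rnorm_oproj_compl (oe m) (d n - x).
by rewrite oprojB dm opprB addrC addrA subrK.
Qed.
End orthonormal.

(** * Riesz-Fischer and adjoints *)

Section operators.
Context {R : realType} {k : scalars} {X : hilbertType R k}.
Local Notation K := (scalar_field R k).
Implicit Types (x y z : X) (a : K) (T S : bounded_operator X).

Lemma bounded_operator_exists (f : X -> X) (C : R) : linear f ->
  (forall x, rnorm (f x) <= C * rnorm x) ->
  exists T : bounded_operator X, forall x, T x = f x.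
Proof.
move=> lf fC.
pose g : {linear X -> X} := HB.pack f (GRing.isLinear.Build K X X *:%R f lf).
have gC : exists C : R, forall x : X, rnorm (g x) <= C * rnorm x by exists C.
by exists (BoundedOperator gC).
Qed.

Lemma operator_bound T :
  exists2 C, 0 <= C & forall x, rnorm (T x) <= C * rnorm x.
Proof.
have [C TC] := bounded_operatorP T; exists (Num.max C 0) => [|x].
  by rewrite le_max lexx orbT.
by apply: le_trans (TC x) _; rewrite ler_wpM2r ?rnorm_ge0 // le_max lexx.
Qed.

(** By homogeneity. The supremum is a genuine upper bound because the operator is bounded. *)
Lemma operator_ballP (M : R) T : 0 <= M ->
  operator_ball X M T <-> (forall x, rnorm (T x) <= M * rnorm x).
Proof.
move=> M0; rewrite /operator_ball /opnorm /=; set A := image _ _.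
have A0 : A !=set0 by exists (rnorm (T 0)), 0 => //=; rewrite rnorm0 ler01.
split=> [TM x|TM]; last first.
  apply: ge_sup => // _ [x /= x1 <-]; apply: le_trans (TM x) _.
  by rewrite -[leRHS]mulr1 ler_wpM2l.
have [->|x0] := eqVneq x 0; first by rewrite linear0 rnorm0 mulr0.
have nx : 0 < rnorm x by rewrite rnorm_gt0.
rewrite -ler_pdivrMr //; apply: le_trans TM; apply: ub_le_sup.
  have [C C0 TC] := operator_bound T.
  exists C => _ [y /= y1 <-]; apply: le_trans (TC y) _.
  by rewrite -[leRHS]mulr1 ler_wpM2l.
exists ((of_real (rnorm x)^-1 : K) *: x) => /=.
  by rewrite rnormZr ?invr_ge0 ?rnorm_ge0 // mulVf // gt_eqF.
by rewrite linearZ /= rnormZr ?invr_ge0 ?rnorm_ge0 // mulrC.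
Qed.

Lemma rnorm_le_eps x (c : R) : 0 <= c ->
  (forall eps : R, 0 < eps -> rnorm x <= c * eps) -> x = 0.
Proof.
move=> c0 h; apply/eqP; rewrite -rnorm_eq0 eq_le rnorm_ge0 andbT.
apply/ler_addgt0Pl => eps e0; rewrite addr0.
have c1 : 0 < c + 1 by lra.
apply: le_trans (h (eps / (c + 1)) _) _; first by rewrite divr_gt0.
by rewrite mulrA ler_pdivrMr // mulrC ler_pM2l //; lra.
Qed.

Section basis.
Variable e : nat -> X.
Hypothesis be : orthonormal_basis e.

Let oe n : orthonormal_upto e n. Proof. exact: be.1. Qed.

Lemma basis_ext x y : (forall i, hdot x (e i) = hdot y (e i)) -> x = y.
Proof.
move=> xy; apply/eqP; rewrite -subr_eq0; apply/eqP.
apply: (@rnorm_le_eps _ 1) => // eps e0; rewrite mul1r.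
have [N /(_ N (leqnn N))] := be.2 (x - y) eps e0.
rewrite /oproj big1 ?subr0; first exact: ltW.
by move=> i _; rewrite hdotBl xy subrr scale0r.
Qed.

(** Squared distances between partial sums [u] are differences of the nondecreasing bounded sums
    [s], so [u] is Cauchy; its limit inherits the coefficients and the bound. *)
Lemma riesz_fischer (c : nat -> K) (C : R) : 0 <= C ->
  (forall n, \sum_(i < n) rabs (c i) ^+ 2 <= C ^+ 2) ->
  exists2 z, forall i, hdot z (e i) = c i & rnorm z <= C.
Proof.
move=> C0 cC; pose s n := \sum_(i < n) rabs (c i) ^+ 2.
pose u n := \sum_(i < n) c i *: e i.
have uS n : u n.+1 = u n + c n *: e n by rewrite /u big_ord_recr.
have sS n : s n.+1 = s n + rabs (c n) ^+ 2 by rewrite /s big_ord_recr.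
have ue n j : hdot (u n) (e j) = if (j < n)%N then c j else 0.
  by apply: (@hdot_sum_on _ _ _ e (maxn n j.+1)) => //;
    rewrite ?leq_maxl ?leq_maxr.
have un n : rnorm (u n) <= C.
  by rewrite -ler_sqr ?nnegrE ?rnorm_ge0 // (@rnorm_sum_on _ _ _ e n).
have usub m p : rnorm (u (m + p)%N - u m) ^+ 2 = s (m + p)%N - s m.
  elim: p => [|p IH]; first by rewrite addn0 !subrr rnorm0 expr0n.
  rewrite addnS uS sS addrAC pythagoras ?IH; last first.
    rewrite hdotZr hdotBl !ue ltnn (_ : (m + p < m)%N = false) ?subrr ?mulr0 //.
    by rewrite ltnNge leq_addr.
  by rewrite rnormZ (rnorm_unit (x := e _)) ?mulr1 1?addrAC // (@oe (m + p).+1)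
    ?eqxx.
have sle m p : s m <= s (m + p)%N by rewrite -subr_ge0 -usub sqr_ge0.
have hs : has_sup (range s).
  by split; [exists (s 0%N), 0%N | exists (C ^+ 2) => _ [n _ <-]; exact: cC].
have [|z zu] := @rnorm_complete _ _ _ u.
  have key (eps : R) : 0 < eps -> exists N, forall m p, (N <= m)%N ->
      rnorm (u (m + p)%N - u m) < eps.
    move=> e0; have [_ [N _ <-] sN] := sup_adherent (exprn_gt0 2 e0) hs.
    exists N => m p Nm; rewrite -ltr_sqr ?nnegrE ?rnorm_ge0 ?(ltW e0) // usub.
    have := sle N (m - N)%N; rewrite subnKC // => h1.
    have h2 : s (m + p)%N <= sup (range s) by apply: ub_le_sup => //; case: hs.
    lra.
  move=> eps /key[N hN]; exists N => m n Nm Nn.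
  have [mn|/ltnW nm] := leqP m n.
    by rewrite rnormB -(subnKC mn) hN.
  by rewrite -(subnKC nm) hN.
exists z => [i|].
  apply/eqP; rewrite -subr_eq0; apply/eqP.
  suff: rabs (hdot z (e i) - c i) = 0.
    by move=> /(congr1 (@of_real R k)); rewrite of_real_rabs of_real0 =>
      /normr0_eq0.
  apply/eqP; rewrite eq_le rabs_ge0 andbT; apply/ler_addgt0Pl => eps e0.
  rewrite addr0; have [N hN] := zu eps e0.
  have := hN (maxn N i.+1) (leq_maxl _ _); rewrite rnormB => /ltW; apply:
    le_trans.
  have -> : c i = hdot (u (maxn N i.+1)) (e i) by rewrite ue leq_maxr.
  rewrite -hdotBl; apply: le_trans (cauchy_schwarz _ _) _.
  by rewrite (rnorm_unit (x := e _)) ?mulr1 // (@oe i.+1) ?eqxx.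
apply/ler_addgt0Pl => eps e0; have [N /(_ N (leqnn N)) hN] := zu eps e0.
have := rnormD (z - u N) (u N); rewrite subrK rnormB => h.
by apply: le_trans h _; rewrite lerD // ltW.
Qed.

(** Riesz-Fischer applied pointwise; linearity follows because coefficients determine a vector. Both
    the adjoint and the shift are built this way. *)
Lemma operator_of_coefficients (F : X -> nat -> K) (C : R) : 0 <= C ->
  (forall a x y i, F (a *: x + y) i = a * F x i + F y i) ->
  (forall x n, \sum_(i < n) rabs (F x i) ^+ 2 <= (C * rnorm x) ^+ 2) ->
  exists2 T : bounded_operator X, forall x i, hdot (T x) (e i) = F x i &
    forall x, rnorm (T x) <= C * rnorm x.
Proof.
move=> C0 Flin FC.
have /choice[f fP] : forall x, exists z,
  (forall i, hdot z (e i) = F x i) /\ rnorm z <= C * rnorm x.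
  by move=> x; have [|z] := riesz_fischer _ (FC x);
    [rewrite mulr_ge0 // rnorm_ge0 | exists z].
have [||T TE] := @bounded_operator_exists f C.
- move=> a x y; apply: basis_ext => i.
  by rewrite hdotDl hdotZl !(fP _).1 Flin.
- by move=> x; case: (fP x).
by exists T => x; rewrite TE; case: (fP x).
Qed.

(** The coefficients of [S y] must be [hdot y (T (e i))]. The identity holds on each finite
    projection of [x] and passes to the limit. *)
Lemma adjoint_exists T : exists S, forall x y, hdot (T x) y = hdot x (S y).
Proof.
have [C C0 TC] := operator_bound T.
have [|||S SE SC] := @operator_of_coefficients (fun y i => hdot y (T (e i))) C.
- by [].
- by move=> a x y i; rewrite hdotDl hdotZl.
- move=> y n; pose w := \sum_(i < n) hdot y (T (e i)) *: e i.
  rewrite -(@rnorm_sum_on _ _ _ e n (@oe _) (fun i => hdot y (T (e i)))) // -/w.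
  (* The left side is [hdot y (T w)]; dividing by [rnorm w] will bound the partial sum by
     [C * rnorm y]. *)
  have h : rnorm w ^+ 2 <= rnorm y * (C * rnorm w).
    apply: le_trans (_ : rabs (hdot y (T w)) <= _); last first.
      by apply: le_trans (cauchy_schwarz _ _) _; rewrite ler_wpM2l ?rnorm_ge0.
    suff -> : hdot y (T w) = of_real (rnorm w ^+ 2)
      by rewrite rabs_of_real ger0_norm ?sqr_ge0.
    rewrite (@rnorm_sum_on _ _ _ e n (@oe _) (fun i => hdot y (T (e i)))) // /w
      linear_sum.
    elim: (n) => [|m IH]; first by rewrite !big_ord0 hdot0r of_real0.
    rewrite !big_ord_recr /= hdotDr IH of_realD linearZ /= hdotZr;
      congr (_ + _).
    by rewrite mulrC mulr_conj.
  rewrite ler_sqr ?nnegrE ?mulr_ge0 ?rnorm_ge0 //.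
  have := rnorm_ge0 w; rewrite le_eqVlt => /predU1P[<-|w0]; first
    by rewrite mulr_ge0 ?rnorm_ge0.
  by rewrite -(ler_pM2r w0) -expr2; apply: le_trans h _; rewrite mulrCA mulrA.
exists S => x y; apply/eqP; rewrite -subr_eq0; apply/eqP.
pose g x := hdot (T x) y - hdot x (S y).
have gP n : g (oproj e n x) = 0.
  elim: n => [|n IH]; first by rewrite /g /oproj big_ord0 linear0 !hdot0l subrr.
  rewrite /g oprojS linearD /= !hdotDl opprD addrACA -/(g _) IH add0r.
  by rewrite linearZ /= !hdotZl [hdot (e n) (S y)]hdotC SE -hdotC subrr.
suff: rabs (g x) = 0.
  by move=> /(congr1 (@of_real R k)); rewrite of_real_rabs of_real0 =>
    /normr0_eq0.
apply/eqP; rewrite eq_le rabs_ge0 andbT; apply/ler_addgt0Pl => eps e0.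
rewrite addr0; pose D := 2 * C * rnorm y + 1.
have D0 : 0 < D by rewrite ltr_wpDl // !mulr_ge0 // rnorm_ge0.
have [N /(_ N (leqnn N))] := be.2 x (eps / D) (divr_gt0 e0 D0).
set r := x - _; move=> rN.
have gE : g x = hdot (T r) y - hdot r (S y).
  have -> : g x = g x - g (oproj e N x) by rewrite gP subr0.
  rewrite /g /r [T (x - _)]linearB /= !hdotBl !opprB.
  by rewrite [LHS]addrACA [RHS]addrACA [X in _ = _ + X]addrC.
have h1 : rabs (hdot (T r) y) <= C * rnorm y * rnorm r.
  by apply: le_trans (cauchy_schwarz _ _) _;
    rewrite mulrAC ler_wpM2r ?rnorm_ge0.
have h2 : rabs (hdot r (S y)) <= C * rnorm y * rnorm r.
  by apply: le_trans (cauchy_schwarz _ _) _; rewrite mulrC ler_wpM2r ?rnorm_ge0.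
have : rabs (g x) <= D * rnorm r.
  rewrite gE; apply: le_trans
    (_ : rabs (hdot (T r) y) + rabs (hdot r (S y)) <= _).
    by rewrite -(@of_real_le _ k) of_realD !of_real_rabs ler_normB.
  have := rnorm_ge0 r; rewrite /D; lra.
move=> /le_trans; apply; rewrite mulrC -ler_pdivlMr //; exact: ltW.
Qed.

Lemma adjointP T x y : hdot (T x) y = hdot x (adjoint T y).
Proof.
have [S SP] := adjoint_exists T.
exact: (@xgetI _ T [set S : bounded_operator X | forall x y,
  hdot (T x) y = hdot x (S y)] S SP x y).
Qed.

Lemma adjoint_unique T y z : (forall x, hdot (T x) y = hdot x z) ->
  adjoint T y = z.
Proof.
move=> Tyz; apply: basis_ext => i.
by rewrite [LHS]hdotC [RHS]hdotC -Tyz -adjointP.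
Qed.

(** For [z := adjoint T y], the square of [rnorm z] is [hdot (T z) y], at most
    [C * rnorm z * rnorm y]. *)
Lemma rnorm_adjoint T (C : R) : (forall x, rnorm (T x) <= C * rnorm x) ->
  forall y, rnorm (adjoint T y) <= C * rnorm y.
Proof.
move=> TC y; set z := adjoint T y.
have := rnorm_ge0 z; rewrite le_eqVlt => /predU1P[z0|z0].
  rewrite -z0; apply: le_trans (TC y); exact: rnorm_ge0.
rewrite -(ler_pM2r z0) -expr2.
have : rabs (hdot z z) = rnorm z ^+ 2
  by rewrite hdotxx rabs_of_real ger0_norm ?sqr_ge0.
move=> <-; rewrite {2}/z -adjointP; apply: le_trans (cauchy_schwarz _ _) _.
by rewrite mulrAC ler_wpM2r ?rnorm_ge0.
Qed.

(** The backward shift by [N] places, bounded by Bessel's inequality. It sends [e (i + N)] to [e i],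
    so [B (adjoint B x)] and [x] have the same coefficients. *)
Lemma shift_exists N : exists B : bounded_operator X,
  [/\ forall x, rnorm (B x) <= rnorm x, forall x, B (adjoint B x) = x,
      forall x, B (oproj e N x) = 0 &
      forall x i, hdot (B x) (e i) = hdot x (e (i + N)%N)].
Proof.
have [|||B BE BC] := @operator_of_coefficients (fun x i => hdot x (e (i + N)%N))
  1.
- exact: ler01.
- by move=> a x y i; rewrite hdotDl hdotZl.
- move=> x n; rewrite mul1r; apply: le_trans (bessel (@oe (N + n)%N) x).
  rewrite big_split_ord /= -[leLHS]add0r lerD // ?sumr_ge0 // => [i _|].
    by rewrite sqr_ge0.
  by under eq_bigr do rewrite addnC.
have Be i : B (e i) = if (i < N)%N then 0 else e (i - N)%N.
  apply: basis_ext => j; rewrite BE (@oe (i + j + N).+1); last 2 first.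
  - by rewrite ltnS -addnA leq_addr.
  - by rewrite ltnS -addnA leq_addl.
  case: ltnP => iN; first by rewrite hdot0l ltn_eqF // ltn_addl.
  by rewrite (@oe (i + j).+1) ?ltnS ?leq_addl ?(leq_trans (leq_subr _ _))
    ?leq_addr // -{1}(subnK iN) eqn_add2r.
exists B; split => //.
- by move=> x; have := BC x; rewrite mul1r.
- move=> x; apply: basis_ext => i; rewrite BE [LHS]hdotC -adjointP Be.
  by rewrite ltnNge leq_addl /= addnK -hdotC.
- move=> x; rewrite /oproj linear_sum big1 // => i _.
  by rewrite linearZ /= Be ltn_ord scaler0.
Qed.

End basis.
End operators.

(** * Growth and decay of geometric sequences *)

Lemma bernoulli_le (R : realType) (h : R) n : 0 <= h ->
  1 + n%:R * h <= (1 + h) ^+ n.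
Proof.
move=> h0; elim: n => [|n IH]; first by rewrite mul0r addr0 expr0.
rewrite exprS; apply: le_trans (_ : (1 + h) * (1 + n%:R * h) <= _).
  have : 0 <= n%:R * h * h by rewrite !mulr_ge0.
  rewrite -natr1; nra.
by rewrite ler_wpM2l // addr_ge0.
Qed.

Lemma geometric_small (R : realType) (q eps : R) j : 0 <= q < 1 -> 0 < eps ->
  exists2 n, (j <= n)%N & q ^+ n < eps.
Proof.
move=> /andP[q0 q1] e0.
have : q ^+ n @[n --> \oo] --> 0 by apply: cvg_expr; rewrite ger0_norm.
move=> /cvgr0Pnorm_lt /(_ eps e0)[N _ hN].
exists (maxn j N); rewrite ?leq_maxl //.
by have := hN _ (leq_maxr j N); rewrite /= ger0_norm // exprn_ge0.
Qed.

(* Even exponents suffice: w^(2m) >= (m (w - 1))^2 by Bernoulli's inequality. *)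
Lemma linear_geometric_small (R : realType) (w eps : R) j : 1 < w -> 0 < eps ->
  exists2 n, (j <= n)%N & n.+1%:R * w^-1 ^+ n < eps.
Proof.
move=> w1 e0; pose h := w - 1; have h0 : 0 < h by rewrite subr_gt0.
(* This gives [3 < m * eps * h ^+ 2], so the linear factor [(m * 2).+1 <= 3 * m] stays below
   [eps * (m * h) ^+ 2]. *)
pose m := (maxn j (Num.truncn (3 / (eps * h ^+ 2)))).+1.
exists (m * 2)%N; first by rewrite /m; have :=
  leq_maxl j (Num.truncn (3 / (eps * h ^+ 2))); lia.
have eh : 0 < eps * h ^+ 2 by rewrite mulr_gt0 ?exprn_gt0.
have hm : 3 < m%:R * (eps * h ^+ 2).
  rewrite -ltr_pdivrMr //; apply: lt_le_trans (truncnS_gt _) _.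
  by rewrite ler_nat ltnS leq_maxr.
have m0 : 0 < m%:R :> R by rewrite ltr0n.
have wm : m%:R * h <= w ^+ m.
  have := bernoulli_le m (ltW h0); rewrite (_ : 1 + h = w); last
    by rewrite /h addrC subrK.
  lra.
have mh0 : 0 < m%:R * h by rewrite mulr_gt0.
have w2 : (m%:R * h) ^+ 2 <= w ^+ (m * 2).
  by rewrite exprM lerXn2r // nnegrE ltW // (lt_le_trans mh0).
rewrite exprVn ltr_pdivrMr; last by apply: lt_le_trans w2; rewrite exprn_gt0.
apply: lt_le_trans (_ : eps * (m%:R * h) ^+ 2 <= _); last by rewrite ler_pM2l.
have : (m * 2).+1%:R <= 3 * m%:R :> R.
  by rewrite -natrM ler_nat; rewrite /m; lia.
move=> /le_lt_trans; apply; rewrite exprMn mulrCA expr2 -mulrA [ltRHS]mulrC.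
by rewrite ltr_pM2r // mulrC.
Qed.

(** * The approximating operator *)

Section compression.
Context {R : realType} {k : scalars} {X : hilbertType R k}.
Local Notation "r *o x" :=
  ((of_real r : scalar_field R k) *: (x : X)) (at level 40).
Implicit Types (x y z : X) (T U S : bounded_operator X).

Lemma of_real_scaleB (c : R) x : c *o x - x = (- (1 - c)) *o x.
Proof. by rewrite opprB of_realD of_realN of_real1 scalerBl scale1r. Qed.

(** Triangle inequality through [P (U (P x))] and [P (U x)]. It is applied both to [T] and to its
    adjoint. *)
Lemma compression_approximation (e : nat -> X) N U (M c : R) x :
  orthonormal_basis e -> 0 <= M -> c <= 1 ->
  (forall x, rnorm (U x) <= M * rnorm x) ->
  rnorm (c *o oproj e N (U (oproj e N x)) - U x) <=
    (1 - c) * M * rnorm x + M * rnorm (x - oproj e N x) +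
    rnorm (U x - oproj e N (U x)).
Proof.
move=> be M0 c1 UM; have oe := be.1 N; set P := oproj e N.
apply: le_trans (rnorm_triangle _ (P (U (P x))) _) _; rewrite -addrA; apply:
  lerD.
  rewrite of_real_scaleB of_realN scaleNr rnormN rnormZr ?subr_ge0 // -mulrA
    ler_wpM2l ?subr_ge0 //.
  apply: le_trans (rnorm_oproj oe _) _; apply: le_trans (UM _) _.
  by rewrite ler_wpM2l // rnorm_oproj.
apply: le_trans (rnorm_triangle _ (P (U x)) _) _; apply: lerD.
  rewrite -oprojB -[U _ - U x]linearB; apply: le_trans (rnorm_oproj oe _) _.
  by apply: le_trans (UM _) _; rewrite ler_wpM2l // rnormB.
by rewrite rnormB.
Qed.

End compression.

Section surgery.
Context {R : realType} {k : scalars} {X : hilbertType R k}.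
Local Notation K := (scalar_field R k).
Local Notation "r *o x" :=
  ((of_real r : scalar_field R k) *: (x : X)) (at level 40).
Variables (e : nat -> X) (T B : bounded_operator X) (N : nat) (M c d w : R).
Hypothesis be : orthonormal_basis e.
Hypothesis TM : forall x, rnorm (T x) <= M * rnorm x.
Hypothesis N0 : (0 < N)%N.
Hypothesis B1 : forall x, rnorm (B x) <= rnorm x.
Hypothesis BK : forall x, B (adjoint B x) = x.
Hypothesis BP : forall x, B (oproj e N x) = 0.
Hypothesis Bshift : forall x i, hdot (B x) (e i) = hdot x (e (i + N)%N).
Hypotheses (M0 : 0 <= M) (c0 : 0 <= c) (d0 : 0 < d) (w1 : 1 < w)
  (cMw : c * M < w).
Hypothesis wdM : w + d <= M.
Implicit Types (x y z : X).

Let P : X -> X := oproj e N.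
Let Q x := x - P x.
Let V := adjoint B.

Let oe : orthonormal_upto e N. Proof. exact: be.1. Qed.
Let P1 x : rnorm (P x) <= rnorm x. Proof. exact: rnorm_oproj. Qed.
Let Q1 x : rnorm (Q x) <= rnorm x. Proof. exact: rnorm_oproj_compl. Qed.
Let PP x : P (P x) = P x. Proof. exact: oproj_idem. Qed.
Let PZ (a : K) x : P (a *: x) = a *: P x. Proof. exact: oprojZ. Qed.
Let PD x y : P (x + y) = P x + P y. Proof. exact: oprojD. Qed.
Let PB x y : P (x - y) = P x - P y. Proof. exact: oprojB. Qed.
Let P0 : P 0 = 0. Proof. exact: oproj0. Qed.
Let PQ x : P (Q x) = 0. Proof. by rewrite PB PP subrr. Qed.
Let QP x : Q (P x) = 0. Proof. by rewrite /Q PP subrr. Qed.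
Let QD x y : Q (x + y) = Q x + Q y. Proof. by rewrite /Q PD opprD addrACA. Qed.
Let QZ (a : K) x : Q (a *: x) = a *: Q x. Proof. by rewrite /Q PZ scalerBr. Qed.
Let QQ x : Q (Q x) = Q x. Proof. by rewrite {1}/Q PQ subr0. Qed.
Let BQ x : B (Q x) = B x. Proof. by rewrite linearB /= BP subr0. Qed.
Let PV x : P (V x) = 0.
Proof.
apply: (basis_ext be) => i; rewrite hdot_oproj hdot0l.
by rewrite [LHS]hdotC -(adjointP be) BP hdot0l scalar_conj0.
Qed.
Let V1 x : rnorm (V x) <= rnorm x.
Proof.
have := rnorm_adjoint be (T := B) (C := 1) _ x; rewrite mul1r; apply.
by move=> y; rewrite mul1r.
Qed.

Definition surgery x := c *o P (T (P x)) + (d *o P (B x) + w *o Q (B x)).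
(** [P] kills the range of [V], so the compression term of [surgery] vanishes here, and the weights
    [d] and [w] are inverted separately on the ranges of [P] and [Q]. *)
Definition surgery_section y := V (d^-1 *o P y + w^-1 *o Q y).

Lemma surgery_linear : linear surgery.
Proof.
move=> a x y; rewrite /surgery !(PD, PZ, linearP, QD, QZ) /=.
rewrite !(scalerDr, scalerA) ![_ * a]mulrC.
by rewrite [LHS](AC (2*(2*2)) ((1*(3*5))*(2*(4*6)))).
Qed.

(** The compression term maps [P x] into the range of [P], the term with [w] maps [Q x] into that of
    [Q]. By Pythagoras they contribute at most [w * rnorm x] together, and the term with [d] adds
    [d * rnorm x]. *)
Lemma rnorm_surgery x : rnorm (surgery x) <= M * rnorm x.
Proof.
have w0 : 0 < w by exact: lt_trans w1.
have h1 : rnorm (c *o P (T (P x)) + w *o Q (B x)) <= w * rnorm x.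
  rewrite -ler_sqr ?nnegrE ?mulr_ge0 ?rnorm_ge0 ?(ltW w0) //.
  rewrite pythagoras; last first.
    by rewrite hdotZl hdotZr (hdot_oproj_compl oe) !mulr0.
  rewrite !rnormZr ?(ltW w0) // [in leRHS]exprMn (oproj_pythagoras oe x) mulrDr
    -!exprMn.
  apply: lerD; rewrite ler_sqr ?nnegrE ?mulr_ge0 ?rnorm_ge0 ?(ltW w0) //.
    apply: le_trans (_ : c * (M * rnorm (P x)) <= _).
      by rewrite ler_wpM2l // (le_trans (P1 _)).
    by rewrite mulrA ler_wpM2r ?rnorm_ge0 // ltW.
  by rewrite ler_pM2l // -BQ (le_trans (Q1 _)).
have h2 : rnorm (d *o P (B x)) <= d * rnorm x.
  by rewrite rnormZr ?(ltW d0) // ler_pM2l // (le_trans (P1 _)).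
rewrite /surgery addrCA; apply: le_trans (rnormD _ _) _.
apply: le_trans (lerD h2 h1) _; rewrite -mulrDl addrC.
by rewrite ler_wpM2r ?rnorm_ge0.
Qed.

Lemma surgery_sectionK y : surgery (surgery_section y) = y.
Proof.
have w0 : w != 0 by rewrite gt_eqF // (lt_trans _ w1).
have dn0 : d != 0 by rewrite gt_eqF.
rewrite /surgery /surgery_section PV linear0 P0 scaler0 add0r BK.
rewrite PD !PZ PP PQ QD !QZ QP QQ !scaler0 addr0 add0r !scalerA.
by rewrite -!of_realM !divff // of_real1 !scale1r addrC subrK.
Qed.

Lemma iter_surgery_sectionK n y : iter n surgery (iter n surgery_section y) = y.
Proof. by elim: n y => // n IH y; rewrite iterSr iterS surgery_sectionK IH. Qed.

(** Only the first application can cost [d^-1]: later ones act on the range of [V], where [P]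
    vanishes, and each gains a factor [w^-1]. *)
Lemma rnorm_surgery_section_iter n y :
  rnorm (iter n.+1 surgery_section y) <= (d^-1 + w^-1) * w^-1 ^+ n * rnorm y.
Proof.
have w0 : 0 < w by exact: lt_trans w1.
elim: n => [|n IH] /=.
  rewrite expr0 mulr1 mulrDl; apply: le_trans (V1 _) _.
  apply: le_trans (rnormD _ _) _.
  by rewrite !rnormZr ?invr_ge0 ?(ltW w0) ?(ltW d0) // lerD // ler_pM2l
    ?invr_gt0.
apply: le_trans (V1 _) _; set u := surgery_section _.
have Pu : P u = 0 by exact: PV.
rewrite Pu scaler0 add0r /Q Pu subr0 rnormZr ?invr_ge0 ?(ltW w0) //.
by rewrite exprS mulrCA -mulrA ler_pM2l ?invr_gt0.
Qed.

(** [B] vanishes on the range of [P], so the [P] component never feeds back into the [Q]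
    component. *)
Lemma Q_iter_surgery n x : Q (iter n surgery x) = w ^+ n *o Q (iter n B x).
Proof.
elim: n => [|n IH]; first by rewrite expr0 of_real1 scale1r.
rewrite iterS /surgery 2!QD 3!QZ 2!QP !scaler0 !add0r QQ -BQ IH linearZ /= QZ
  BQ.
by rewrite scalerA -of_realM exprS.
Qed.

Lemma surgery_kernel_dense x (eps : R) : 0 < eps ->
  exists2 z, rnorm (z - x) < eps & exists n, iter n surgery z = 0.
Proof.
move=> e0; have w0 : 0 < w by exact: lt_trans w1.
have e2 : 0 < eps / 2 by lra.
have [m /(_ m (leqnn m))] := be.2 x _ e2; set u := oproj e m x => xu.
(* [u] is a combination of the first [m] basis vectors, and each [B] lowers indices by [N], which is
   positive. *)
have Bu j : (m <= j)%N -> iter j B u = 0.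
  move=> mj; apply: (basis_ext be) => i; rewrite hdot0l.
  have -> : hdot (iter j B u) (e i) = hdot u (e (i + j * N)%N).
    by elim: (j) i => [|l IH] i /=; rewrite ?addn0 // Bshift IH mulSn addnA.
  have mN : (m <= i + j * N)%N.
    by rewrite (leq_trans mj) // (leq_trans (leq_pmulr j N0)) // leq_addl.
  rewrite (@hdot_sum_on _ _ _ e (i + j * N).+1 (be.1 _) (fun i => hdot x (e i)))
    ?ltnS //; last exact: leqW.
  by rewrite ltnNge mN.
(* From time [m] on, the orbit of [u] stays in the range of [P]; there only the compression term
   acts, with growth factor at most [c * M]. *)
pose v := iter m surgery u.
have cM0 : 0 <= c * M by rewrite mulr_ge0.
have vb j : rnorm (iter j surgery v) <= (c * M) ^+ j * rnorm v.
  elim: j => [|j IH]; first by rewrite expr0 mul1r.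
  rewrite iterS; set y := iter j surgery v.
  have yP : y = P y.
    apply/eqP; rewrite -subr_eq0 -/(Q y) /y /v -iterD Q_iter_surgery Bu
      ?leq_addl //.
    by rewrite /Q P0 subrr scaler0.
  have By : B y = 0 by rewrite yP BP.
  rewrite /surgery By /Q P0 subrr !scaler0 !addr0 rnormZr // exprS -!mulrA.
  rewrite ler_wpM2l //; apply: le_trans (P1 _) _; apply: le_trans (TM _) _.
  by rewrite ler_wpM2l // -yP.
(* The correction subtracted from [u] below has norm at most [(c * M / w) ^+ j * L]; the 1 makes [L]
   positive. *)
pose L := (d^-1 + w^-1) * (c * M) * rnorm v + 1.
have L0 : 0 < L.
  by rewrite ltr_wpDl // !mulr_ge0 ?rnorm_ge0 ?addr_ge0 ?invr_ge0 ?(ltW w0)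
    ?(ltW d0).
have q01 : 0 <= c * M / w < 1
  by rewrite divr_ge0 ?(ltW w0) //= ltr_pdivrMr // mul1r.
have [j _ jq] := geometric_small 0%N q01 (divr_gt0 e2 L0).
pose n := (j + m)%N.
exists (u - iter n.+1 surgery_section (iter n.+1 surgery u)).
  rewrite addrAC [ltRHS]splitr; apply: le_lt_trans (rnormD _ _) _.
  rewrite rnormN rnormB ltr_leD //.
  apply: le_trans (rnorm_surgery_section_iter _ _) _.
  have -> : iter n.+1 surgery u = iter j.+1 surgery v by rewrite /v -iterD.
  apply: le_trans (_ : (d^-1 + w^-1) * (w^-1 ^+ j) * ((c * M) ^+ j.+1 * rnorm v)
    <= _).
    rewrite ler_pM ?rnorm_ge0 ?mulr_ge0 ?addr_ge0 ?exprn_ge0 ?invr_ge0 ?(ltW w0)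
      ?(ltW d0) //.
    rewrite ler_wpM2l ?addr_ge0 ?invr_ge0 ?(ltW w0) ?(ltW d0) //.
    rewrite /n exprD ler_piMr ?exprn_ge0 ?invr_ge0 ?(ltW w0) //.
    by rewrite exprn_ile1 ?invr_ge0 ?(ltW w0) // invf_le1 // ltW.
  move: jq; rewrite ltr_pdivlMr // => /ltW; apply: le_trans.
  have -> : (d^-1 + w^-1) * w^-1 ^+ j * ((c * M) ^+ j.+1 * rnorm v) =
      (c * M / w) ^+ j * ((d^-1 + w^-1) * (c * M) * rnorm v).
    rewrite [(c * M / w) ^+ j]exprMn exprS.
    by move: (d^-1 + w^-1) (w^-1 ^+ j) ((c * M) ^+ j) (c * M) => a1 a2 a3 a4;
      ring.
  by rewrite ler_wpM2l ?exprn_ge0 ?divr_ge0 ?(ltW w0) // /L lerDl.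
exists n.+1.
have lin p x' y :
    iter p surgery (x' - y) = iter p surgery x' - iter p surgery y.
  elim: p => // l IH; rewrite !iterS IH addrC -scaleN1r surgery_linear.
  by rewrite scaleN1r addrC.
by rewrite lin iter_surgery_sectionK subrr.
Qed.

(** [B] sees only [Q x], so the terms added to the compression have norm at most
    [(w + d) * rnorm (Q x)]. *)
Lemma surgery_approximation x : c <= 1 ->
  rnorm (surgery x - T x) <=
    (1 - c) * M * rnorm x + 2 * M * rnorm (Q x) + rnorm (Q (T x)).
Proof.
move=> c1; have w0 : 0 < w by exact: lt_trans w1.
have -> : surgery x - T x =
    (c *o P (T (P x)) - T x) + (d *o P (B x) + w *o Q (B x))
      by rewrite /surgery addrAC.
apply: le_trans (rnormD _ _) _.
have h1 := compression_approximation N x be M0 c1 TM.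
have h2 : rnorm (d *o P (B x) + w *o Q (B x)) <= M * rnorm (Q x).
  apply: le_trans (_ : (w + d) * rnorm (Q x) <= _); last
    by rewrite ler_wpM2r ?rnorm_ge0.
  apply: le_trans (rnormD _ _) _; rewrite !rnormZr ?(ltW w0) ?(ltW d0) //.
  rewrite addrC mulrDl -BQ; apply: lerD; rewrite ler_pM2l //.
    by apply: le_trans (Q1 _) _.
  by apply: le_trans (P1 _) _.
apply: le_trans (lerD h1 h2) _; rewrite -/P -/(Q x) -/(Q (T x)).
by move: (rnorm x) (rnorm (Q x)) (rnorm (Q (T x))) => a1 a2 a3; lra.
Qed.

Lemma adjoint_surgery (S : bounded_operator X) y :
  (forall x, S x = surgery x) ->
  adjoint S y = c *o P (adjoint T (P y)) + (d *o V (P y) + w *o V (Q y)).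
Proof.
move=> SE; apply: (adjoint_unique be) => x.
rewrite SE /surgery !hdotDl !hdotDr !hdotZl !hdotZr !scalar_conj_of_real.
rewrite !hdot_oproj (adjointP be) hdot_oproj (adjointP be);
  congr (_ + (_ + _ * _)).
by rewrite -(adjointP be) hdotBr hdotBl hdot_oproj.
Qed.

(** In the adjoint, [d *o V (P x)] does not fade as [N] grows; this is why [d] must be small. *)
Lemma adjoint_surgery_approximation (S : bounded_operator X) x :
  c <= 1 -> (forall x, S x = surgery x) ->
  rnorm (adjoint S x - adjoint T x) <=
    ((1 - c) * M + d) * rnorm x + 2 * M * rnorm (Q x) + rnorm (Q (adjoint T x)).
Proof.
move=> c1 /adjoint_surgery ->; have w0 : 0 < w by exact: lt_trans w1.
rewrite addrAC; apply: le_trans (rnormD _ _) _.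
have h1 := compression_approximation N x be M0 c1 (rnorm_adjoint be TM).
have h2 : rnorm (d *o V (P x) + w *o V (Q x)) <= d * rnorm x + M * rnorm (Q x).
  apply: le_trans (rnormD _ _) _; rewrite !rnormZr ?(ltW w0) ?(ltW d0) //.
  apply: lerD; first by rewrite ler_pM2l // (le_trans (V1 _)).
  apply: le_trans (_ : w * rnorm (Q x) <= _); first by rewrite ler_pM2l.
  by rewrite ler_wpM2r ?rnorm_ge0 // (le_trans _ wdM) // lerDl ltW.
apply: le_trans (lerD h1 h2) _; rewrite -/P -/(Q x) -/(Q (adjoint T x)).
by move: (rnorm x) (rnorm (Q x)) (rnorm (Q (adjoint T x))) => a1 a2 a3; lra.
Qed.

End surgery.

(** * Strong* approximation inside the ball *)

Section approximation.
Context {R : realType} {k : scalars} {X : hilbertType R k}.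
Local Notation "r *o x" :=
  ((of_real r : scalar_field R k) *: (x : X)) (at level 40).
Implicit Types (x y z : X) (T U S : bounded_operator X).

Lemma uniform_basis_approximation (e : nat -> X) (s : seq X) (eps : R) :
  orthonormal_basis e -> 0 < eps ->
  exists N, forall n x, (N <= n)%N -> x \in s -> rnorm (x - oproj e n x) < eps.
Proof.
move=> be e0; elim: s => [|y s [N hN]]; first by exists 0%N.
have [N' hN'] := be.2 y eps e0; exists (maxn N N') => n x.
rewrite geq_max inE => /andP[Nn N'n] /predU1P[->|]; first exact: hN'.
exact: hN.
Qed.

Lemma rnorm_seq_bound (s : seq X) :
  exists2 C, 0 <= C & forall x, x \in s -> rnorm x <= C.
Proof.
elim: s => [|y s [C C0 hC]]; first by exists 0.
exists (Num.max C (rnorm y)) => [|x]; first by rewrite le_max C0.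
by rewrite inE le_max => /predU1P[->|/hC ->//]; rewrite lexx orbT.
Qed.

(** The last two clauses keep what the dynamics uses: a dense set of vectors whose orbit reaches 0,
    and a right inverse [F] with geometrically decaying iterates. *)
Lemma perturbation (M : R) T (s : seq X) (eps : R) :
  infinite_dimensional X -> separable X -> 1 < M -> 0 < eps ->
  (forall x, rnorm (T x) <= M * rnorm x) ->
  exists S, [/\ forall x, rnorm (S x) <= M * rnorm x,
    sstar_basic T s eps S,
    forall x (dlt : R), 0 < dlt ->
      exists2 z, rnorm (z - x) < dlt & exists n, iter n S z = 0 &
    exists (F : X -> X) (L w : R), [/\ 0 <= L, 1 < w,
      forall n y, iter n S (iter n F y) = y &
      forall n y, rnorm (iter n.+1 F y) <= L * w^-1 ^+ n * rnorm y]].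
Proof.
move=> hdim hsep M1 eps0 TM.
have [e be] := orthonormal_basis_exists hdim hsep.
have M0 : 0 < M by lra.
have [C C0 sC] := rnorm_seq_bound s.
have D0 : 0 < 4 * M * (C + 1) + eps by rewrite ltr_wpDl // !mulr_ge0 //; lra.
(* One parameter governs [c], [d] and [w]. It is below 1 and makes [2 * (eta * M * C)] less than
   [eps / 2]; later [d = eta * (M - 1)] leaves [w > 1], and [c * M = M - eta * M < w]. *)
pose eta := eps / (4 * M * (C + 1) + eps).
have eta0 : 0 < eta by rewrite divr_gt0.
have eta1 : eta < 1 by rewrite ltr_pdivrMr // mul1r ltrDr !mulr_gt0 //; lra.
have etaC : 2 * (eta * M * C) < eps / 2.
  have -> : 2 * (eta * M * C) = eps * (2 * M * C) / (4 * M * (C + 1) + eps).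
    by rewrite /eta; ring.
  rewrite ltr_pdivrMr //; have := mulr_gt0 eps0 M0; have := mulr_gt0 eps0 eps0;
    nra.
(* The estimates involve the tails of [x], [T x] and [adjoint T x]. The tolerance gives
   [2 * M * a + b < eps / 2] for [a] and [b] below it. *)
have [|N hN] := uniform_basis_approximation (s ++ map T s ++ map (adjoint T) s)
  (eps := eps / (4 * M + 4)) be.
  by rewrite divr_gt0 //; lra.
(* The successor makes the shift length positive. *)
pose n := N.+1; have {}hN := hN n _ (leqnSn N).
have [B [B1 BK BP Bs]] := shift_exists be n.
pose c := 1 - eta; pose d := eta * (M - 1); pose w := M - d.
have d0 : 0 < d by rewrite mulr_gt0 //; lra.
have dM : d < M - 1 by rewrite gtr_pMl //; lra.
have w1 : 1 < w by rewrite /w; lra.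
have c0 : 0 <= c by rewrite /c; lra.
have cMw : c * M < w by rewrite /c /w /d; nra.
have wdM : w + d <= M by rewrite /w; lra.
have c1 : c <= 1 by rewrite /c; lra.
have [S SE] := bounded_operator_exists (@surgery_linear _ _ _ e T B n c d w)
  (@rnorm_surgery _ _ _ e T B n M c d w be TM B1 BP c0 d0 w1 cMw wdM).
have M40 : 0 < 4 * M + 4 by lra.
have sum_small (a b : R) : a < eps / (4 * M + 4) -> b < eps / (4 * M + 4) ->
    2 * M * a + b < eps / 2.
  rewrite !ltr_pdivlMr // => ha hb.
  rewrite -(ltr_pM2r M40); nra.
have iterE m x : iter m S x = iter m (surgery e T B n c d w) x.
  by elim: m => //= m ->; rewrite SE.
exists S; split.
- by move=> x; rewrite SE; apply: rnorm_surgery.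
- move=> x xs; have xC := sC x xs.
  have Qx : rnorm (x - oproj e n x) < eps / (4 * M + 4) by apply: hN;
    rewrite mem_cat xs.
  have QTx : rnorm (T x - oproj e n (T x)) < eps / (4 * M + 4).
    by apply: hN; rewrite !mem_cat map_f ?orbT.
  have QTx' : rnorm (adjoint T x - oproj e n (adjoint T x)) < eps / (4 * M + 4).
    by apply: hN; rewrite !mem_cat (map_f (adjoint T)) ?orbT.
  have eM : 0 < eta * M by rewrite mulr_gt0.
  (* The coefficients of [rnorm x] in the two estimates are [eta * M] and
     [eta * M + eta * (M - 1)]. *)
  have small (a : R) : 0 <= a -> a <= 2 * (eta * M) -> a * rnorm x < eps / 2.
    move=> a0 aM; apply: le_lt_trans etaC.
    by rewrite mulrA ler_pM ?rnorm_ge0.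
  rewrite [eps]splitr SE; split.
  + apply: le_lt_trans (surgery_approximation be TM B1 BP (ltW M0) d0 w1 wdM x
      c1) _.
    rewrite -addrA ltrD ?sum_small // small //; rewrite /c; nra.
  + apply: le_lt_trans (adjoint_surgery_approximation be TM B1 (ltW M0) d0 w1
      wdM x c1 SE) _.
    rewrite -addrA ltrD ?sum_small // small //; rewrite /c /d; nra.
- move=> x dlt dlt0.
  have [z zx [m mz]] := surgery_kernel_dense be TM (ltn0Sn N) B1 BK BP Bs
    (ltW M0) c0 d0 w1 cMw x dlt0.
  by exists z => //; exists m; rewrite iterE.
- exists (surgery_section e B n d w), (d^-1 + w^-1), w; split=> //.
  + by rewrite addr_ge0 ?invr_ge0 ?(ltW d0) // ltW // (lt_trans _ w1).
  + by move=> m y; rewrite iterE; exact: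
      (iter_surgery_sectionK T c be BK BP d0 w1).
  + exact: (rnorm_surgery_section_iter be B1 BP d0 w1).
Qed.

End approximation.

(** * Limits inferior and superior as countably many conditions *)

Section limits.
Context {R : realType}.
Implicit Type a : nat -> R.

(** One integer [l] serves as index bound and as threshold; taking it large covers every pair of the
    two. *)
Lemma limn_esup_pinftyP a : limn_esup (EFin \o a) = +oo%E <->
  forall l : nat, exists2 n, (l <= n)%N & l%:R < a n.
Proof.
rewrite limn_esup_lim (cvg_lim _ (@cvg_esups_inf _ (EFin \o a))) //; split.
  move=> ioo l.
  have : (l%:R%:E < ereal_sup (sdrop (EFin \o a) l))%E.
    apply: lt_le_trans (ltry l%:R) _; rewrite -ioo; apply: ereal_inf_lbound.
    by exists l.
  by move=> /ereal_sup_gt[_ [n /= ln <-]]; rewrite lte_fin; exists n.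
move=> h; apply/eqP; rewrite -leye_eq; apply: le_ereal_inf_tmp => _ [m _ <-].
rewrite leye_eq; apply/eqP/eqyP => r _.
have [n mn an] := h (maxn m (Num.truncn r).+1).
apply: le_trans (_ : (a n)%:E <= _)%E; last first.
  by apply: ereal_sup_ubound; exists n => //=; exact:
    leq_trans (leq_maxl _ _) mn.
rewrite lee_fin; apply: le_trans (ltW an); apply:
  le_trans (ltW (truncnS_gt r)) _.
by rewrite ler_nat leq_maxr.
Qed.

(** Nonnegativity gives one inequality; for the other, an [l] beyond both the tail index and
    [eps^-1] puts each tail infimum below [eps]. *)
Lemma limn_einf_eq0P a : (forall n, 0 <= a n) ->
  limn_einf (EFin \o a) = 0%E <->
  forall l : nat, exists2 n, (l <= n)%N & a n < l.+1%:R^-1.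
Proof.
move=> a0; rewrite limn_einf_lim (cvg_lim _ (@cvg_einfs_sup _ (EFin \o a))) //;
  split.
  move=> i0 l.
  have : (ereal_inf (sdrop (EFin \o a) l) < (l.+1%:R^-1)%:E)%E.
    apply: le_lt_trans (_ : (0 < _)%E); last by rewrite lte_fin invr_gt0.
    by rewrite -i0; apply: ereal_sup_ubound; exists l.
  by move=> /ereal_inf_lt[_ [n /= ln <-]]; rewrite lte_fin; exists n.
move=> h; apply/eqP; rewrite eq_le; apply/andP; split; last first.
  apply: le_trans (_ : einfs (EFin \o a) 0%N <= _)%E; last by apply:
    ereal_sup_ubound; exists 0%N.
  by apply: le_ereal_inf_tmp => _ [n _ <-]; rewrite lee_fin.
apply: ge_ereal_sup => _ [m _ <-]; apply/lee_addgt0Pr => eps e0; rewrite add0e.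
pose l := Num.truncn eps^-1; have [n mn an] := h (maxn m l).
apply: le_trans (_ : (a n)%:E <= _)%E.
  by apply: ereal_inf_lbound; exists n => //=; exact:
    leq_trans (leq_maxl _ _) mn.
rewrite lee_fin; apply: le_trans (ltW an) _; rewrite invf_ple ?posrE //.
apply: le_trans (ltW (truncnS_gt _)) _.
by rewrite ler_nat ltnS leq_maxr.
Qed.
End limits.

(** * Baire category *)

Section topology.
Context {R : realType} {k : scalars} {X : hilbertType R k}.
Implicit Types (x y z : X) (T S : bounded_operator X).

Definition rball x (r : R) := [set y | rnorm (y - x) < r].

Lemma rball_open x r : open (rball x r).
Proof.
rewrite openE => y /= yx; apply/nbhs_rnormP; exists (r - rnorm (y - x)).
  by rewrite subr_gt0.
move=> z; rewrite ltrBrDr; apply: le_lt_trans; exact: rnorm_triangle.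
Qed.

Lemma rball_center x r : 0 < r -> rball x r x.
Proof. by rewrite /rball /= rnorm_subrr. Qed.

Lemma open_rball (O : set X) x : open O -> O x ->
  exists2 r, 0 < r & rball x r `<=` O.
Proof. by rewrite openE => oO /oO /nbhs_rnormP. Qed.

(* [Baire] of the library requires the scalars to be a [realType], which
   excludes the complex case. *)
Lemma baire_hilbert (F : nat -> set X) :
  (forall i, open (F i) /\ dense (F i)) ->
  dense (\bigcap_i F i).
Proof.
move=> Fd O [x0 Ox0] oO.
have [r0 r00 r0O] := open_rball oO Ox0.
(* The state is a center with a radius. The next closed ball lies in the current open ball and in
   the dense open set; the guard on the radius makes the choice total. *)
have step (p : nat * (X * R)) : exists q : X * R, 0 < p.2.2 ->
    [/\ 0 < q.2, q.2 < p.1.+1%:R^-1 &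
     forall y, rnorm (y - q.1) <= q.2 -> rball p.2.1 p.2.2 y /\ F p.1 y].
  case: p => n [x r] /=; have [r0'|] := ltP 0 r; last by exists (x, r).
  have [||y [xy Fy]] := (Fd n).2 (rball x r).
  - by exists x; exact: rball_center.
  - exact: rball_open.
  have oI : open (rball x r `&` F n) by apply: openI;
    [exact: rball_open | exact: (Fd n).1].
  have [s s0 sI] := open_rball oI (conj xy Fy).
  exists (y, Num.min (s / 2) (n.+1%:R^-1 / 2)) => _; split => /=.
  - by rewrite lt_min !divr_gt0.
  - by rewrite gt_min [X in _ || X](_ : _ = true) ?orbT // ltr_pdivrMr //
      ltr_pMr ?invr_gt0 // ltr1n.
  - move=> z; rewrite le_min => /andP[zs _]; apply: sI.
    by rewrite /rball /=; apply: le_lt_trans zs _; lra.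
have [f fP] := choice step.
pose g := fix g n : X * R := if n is m.+1 then f (m, g m) else (x0, r0).
have g0 n : 0 < (g n).2 by elim: n => //= n IH; case: (fP (n, g n) IH).
have gS n : [/\ (g n.+1).2 < n.+1%:R^-1 &
     forall y, rnorm (y - (g n.+1).1) <= (g n.+1).2 ->
       rball (g n).1 (g n).2 y /\ F n y].
  by case: (fP (n, g n) (g0 n)).
have nested m p y : rnorm (y - (g (m + p)%N).1) <= (g (m + p)%N).2 ->
    rnorm (y - (g m).1) <= (g m).2.
  elim: p => [|p IH]; first by rewrite addn0.
  by rewrite addnS => /(gS _).2[h _]; apply: IH; exact: ltW.
have center m n : (m <= n)%N -> rnorm ((g n).1 - (g m).1) <= (g m).2.
  move=> mn; apply: (nested m (n - m)%N); rewrite subnKC // rnorm_subrr.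
  exact: ltW.
have [|l lim_l] := rnorm_complete (u := fun n => (g n).1).
  move=> eps e0; pose N := (Num.truncn (2 / eps)).+1.
  have gN : (g N).2 < eps / 2.
    apply: lt_trans (gS _).1 _; rewrite invf_plt ?posrE ?divr_gt0 // invf_div.
    exact: truncnS_gt.
  exists N => m n Nm Nn; apply: le_lt_trans (rnorm_triangle _ (g N).1 _) _.
  rewrite [ltRHS]splitr ltrD //; first by apply: le_lt_trans gN; exact: center.
  by rewrite rnormB; apply: le_lt_trans gN; exact: center.
(* All centers from [m] on lie in the closed ball of index [m], hence so does their limit. *)
have inside m : rnorm (l - (g m).1) <= (g m).2.
  apply/ler_addgt0Pl => eps e0; have [N hN] := lim_l eps e0.
  apply: le_trans (rnorm_triangle _ (g (maxn m N)).1 _) _.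
  by rewrite lerD ?center ?leq_maxl // rnormB ltW // hN // leq_maxr.
exists l; split.
  by apply: r0O; case: ((gS 0%N).2 _ (inside 1%N)).
by move=> i _; case: ((gS i).2 _ (inside i.+1)).
Qed.

Lemma countable_base : separable X -> exists U : nat -> set X,
  [/\ forall i, open (U i), forall i, U i !=set0 &
   forall O : set X, open O -> O !=set0 -> exists i, U i `<=` O].
Proof.
move=> /dense_sequence[d dP].
pose V (p : nat * nat) := rball (d p.1) p.2.+1%:R^-1.
(* Integers that code no pair repeat the ball of [(0, 0)], so every member is nonempty. *)
exists (fun i => V (odflt (0, 0)%N (unpickle i))); split.
- by move=> i; exact: rball_open.
- by move=> i; eexists; apply: rball_center; rewrite invr_gt0.
move=> O oO [x Ox]; have [r r0 rO] := open_rball oO Ox.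
pose m := Num.truncn (2 / r).
have mr : m.+1%:R^-1 < r / 2.
  by rewrite invf_plt ?posrE ?divr_gt0 // invf_div; exact: truncnS_gt.
have [n dn] := dP x (r / 2) (divr_gt0 r0 (ltr0n _ 2)).
exists (pickle (n, m)); rewrite pickleK /= => y yd; apply: rO.
rewrite /rball /=; apply: le_lt_trans (rnorm_triangle _ (d n) _) _.
rewrite [ltRHS]splitr ltrD //; exact: lt_trans yd mr.
Qed.

Lemma dense_base (U : nat -> set X) (D : set X) :
  (forall O : set X, open O -> O !=set0 -> exists i, U i `<=` O) ->
  (forall i, exists2 x, U i x & D x) -> dense D.
Proof.
move=> Ub UD O O0 oO; have [i iO] := Ub O oO O0.
by have [x Ux Dx] := UD i; exists x; split => //; exact: iO.
Qed.

End topology.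

(** * Hypercyclicity and orbit means as open conditions *)

Section dynamics.
Context {R : realType} {k : scalars} {X : hilbertType R k}.
Local Notation K := (scalar_field R k).
Implicit Types (x y z : X) (T S : bounded_operator X).

Lemma continuous_rnormP (Y : topologicalType) (f : Y -> X) :
  (forall (y : Y) (eps : R), 0 < eps -> \forall y' \near y,
    rnorm (f y' - f y) < eps) ->
  continuous f.
Proof.
move=> h y A /nbhs_rnormP[eps e0 eA].
by apply: filterS (h y eps e0) => y' /eA.
Qed.

Lemma near_rnorm (Y : topologicalType) (f : Y -> X) (y : Y) (eps : R) :
  continuous f ->
  0 < eps -> \forall y' \near y, rnorm (f y' - f y) < eps.
Proof.
move=> fc e0; have /fc : nbhs (f y) [set z | rnorm (z - f y) < eps]
  by apply/nbhs_rnormP; exists eps.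
by [].
Qed.

Lemma rnorm_continuous : continuous (@rnorm R k X).
Proof.
move=> x; apply/cvgrPdist_lt => eps e0; apply/nbhs_rnormP; exists eps =>
  // y yx.
have h1 : rnorm y <= rnorm (y - x) + rnorm x by have := rnormD (y - x) x;
  rewrite subrK.
have h2 : rnorm x <= rnorm (y - x) + rnorm y.
  by have := rnormD (x - y) y; rewrite subrK rnormB.
by rewrite /= ltr_norml; apply/andP; split; lra.
Qed.

(** [Y] will be [X] for a fixed operator, and the operator ball for a fixed vector. *)
Lemma mean_continuous (Y : topologicalType) (g : nat -> Y -> X) n :
  (forall i, continuous (g i)) ->
  continuous (fun s => n%:R^-1 * \sum_(1 <= i < n.+1) rnorm (g i s) : R).
Proof.
move=> gc s; apply: cvgMr.
apply: cvg_big => [|i _]; last exact: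
  continuous_comp (gc i s) (@rnorm_continuous _).
exact: add_continuous.
Qed.

Lemma iter_linearD T n x y : iter n T (x + y) = iter n T x + iter n T y.
Proof. by elim: n => //= n ->; rewrite linearD. Qed.

Lemma iter_linear0 T n : iter n T (0 : X) = 0.
Proof. by elim: n => //= n ->; rewrite linear0. Qed.

Lemma operator_continuous T : continuous T.
Proof.
have [C C0 TC] := operator_bound T; apply: continuous_rnormP => x eps e0.
have C1 : 0 < C + 1 by lra.
apply/nbhs_rnormP; exists (eps / (C + 1)); first by rewrite divr_gt0.
move=> y; rewrite ltr_pdivlMr // => yx; rewrite -linearB.
apply: le_lt_trans (TC _) _; apply: le_lt_trans yx.
by rewrite mulrC ler_wpM2l ?rnorm_ge0 // lerDl.
Qed.

Lemma iter_continuous T n : continuous (iter n T).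
Proof.
elim: n => [|n IH] x; first exact: cvg_id.
exact: continuous_comp (IH x) (@operator_continuous T _).
Qed.

(** With [y = T^n x], the difference of the next iterates is [S (S^n x - T^n x) + (S y - T y)]: the
    uniform bound [M] controls the first term, a strong* neighbourhood the second. *)
Lemma iter_ball_continuous (M : R) n x : 0 <= M ->
  continuous (fun S : set_type (operator_ball X M) => iter n (\val S) x).
Proof.
move=> M0; elim: n => [|n IH]; first exact: cst_continuous.
apply: continuous_rnormP => T eps e0.
have M1 : 0 < M + 1 by lra.
have e2 : 0 < eps / 2 by lra.
have eM : 0 < eps / 2 / (M + 1) by rewrite divr_gt0.
pose y := iter n (\val T) x.
have valT : \forall S \near T, sstar_basic (\val T) [:: y] (eps / 2) (\val S).
  apply: (@initial_continuous (set_type (operator_ball X M)) _ set_val T).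
  by exists [:: y], (eps / 2); split.
apply: filterS2 valT (near_rnorm T IH eM) => S /(_ y (mem_head _ _))[+ _] Sn.
rewrite !iterS -/y => STy.
have SM : forall x, rnorm (\val S x) <= M * rnorm x.
  by apply/(operator_ballP _ M0)/set_mem/(valP S).
apply: le_lt_trans (rnorm_triangle _ (\val S y) _) _; rewrite [ltRHS]splitr.
apply: ler_ltD STy; rewrite -linearB; apply: le_trans (SM _) _.
move: Sn; rewrite ltr_pdivlMr // => /ltW; apply: le_trans.
by rewrite mulrC ler_wpM2l ?rnorm_ge0 // lerDl.
Qed.

Definition small_means T (l : nat) :=
  [set x | exists2 n, (l <= n)%N & orbit_mean T x n < l.+1%:R^-1].

Definition large_means T (l : nat) :=
  [set x | exists2 n, (l <= n)%N & l%:R < orbit_mean T x n].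

Lemma orbit_mean_ge0 (T : X -> X) x n : 0 <= orbit_mean T x n.
Proof. by rewrite mulr_ge0 ?invr_ge0 // sumr_ge0 // => i _; exact:
  rnorm_ge0. Qed.

Lemma absolutely_mean_irregularE T :
  absolutely_mean_irregular T = \bigcap_l (small_means T l `&` large_means T l).
Proof.
have a0 x := limn_einf_eq0P (orbit_mean_ge0 T x).
apply/seteqP; split=> [x [/a0 h1 /limn_esup_pinftyP h2] l _|x h]; first
  by split.
by split; [apply/a0 => l | apply/limn_esup_pinftyP => l]; case: (h l).
Qed.

Lemma open_exists (Y Z : topologicalType) (f : nat -> Y -> Z) (l : nat)
  (O : set Z) :
  open O -> (forall n, continuous (f n)) ->
  open [set y : Y | exists2 n, (l <= n)%N & O (f n y)].
Proof.
move=> oO fc; rewrite openE => y [n ln Ofn].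
have : nbhs y (f n @^-1` O) by apply: (fc n); exact: open_nbhs_nbhs.
by apply: filterS => y' Oy'; exists n.
Qed.

Lemma small_means_open T l : open (small_means T l).
Proof.
apply: (@open_exists _ _ (fun n x => orbit_mean T x n) l
  [set r | r < l.+1%:R^-1]).
  exact: open_lt.
by move=> n; apply: mean_continuous => i; exact: iter_continuous.
Qed.

Lemma large_means_open T l : open (large_means T l).
Proof.
apply: (@open_exists _ _ (fun n x => orbit_mean T x n) l [set r | l%:R < r]).
  exact: open_gt.
by move=> n; apply: mean_continuous => i; exact: iter_continuous.
Qed.

Lemma dense_openI (A B : set X) : open A -> dense A -> dense B ->
  dense (A `&` B).
Proof.
move=> oA dA dB O O0 oO; have [x [Ox [Ax Bx]]] : O `&` (A `&` B) !=set0.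
  by rewrite setIA; apply: dB; [exact: dA | exact: openI].
by exists x.
Qed.

Variable U : nat -> set X.
Hypothesis oU : forall i, open (U i).
Hypothesis U0 : forall i, U i !=set0.
Hypothesis Ub : forall O : set X, open O -> O !=set0 -> exists i, U i `<=` O.

(** Forward, a dense set meets every [U i]. Conversely, both open sets are dense for each [l], so by
    Baire their intersection over all [l] is a dense Gdelta. *)
Lemma residual_meanP T :
  residual [set x : X | absolutely_mean_irregular T x] <->
  forall i l, U i `&` small_means T l !=set0 /\ U i `&` large_means T l !=set0.
Proof.
rewrite /= -[X in residual X]/(absolutely_mean_irregular T : set X)
  absolutely_mean_irregularE; split.
  move=> [G [_ dG GA]] i l; have [x [Ux Gx]] := dG (U i) (U0 i) (oU i).
  by have [? ?] := GA _ Gx l I; split; exists x.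
move=> h; exists (\bigcap_l (small_means T l `&` large_means T l)); split=> //.
  exists (fun l => small_means T l `&` large_means T l) => // l.
  by apply: openI; [exact: small_means_open | exact: large_means_open].
apply: baire_hilbert => l; split.
  by apply: openI; [exact: small_means_open | exact: large_means_open].
apply: dense_openI; first exact: small_means_open.
- by apply: (dense_base Ub) => i; have [[x [? ?]] _] := h i l; exists x.
- by apply: (dense_base Ub) => i; have [_ [x [? ?]]] := h i l; exists x.
Qed.

Lemma nonzero_vector : infinite_dimensional X -> exists u : X, hdot u u = 1.
Proof.
move=> hdim; have [|u [u1 _ _]] :=
  @orthonormal_extension R k X (fun=> 0) 0 _ hdim 0; last by exists u.
by [].
Qed.

Lemma open_no_isolated (O : set X) p : infinite_dimensional X ->
  open O -> O !=set0 -> O `\` [set p] !=set0.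
Proof.
move=> hdim oO [y Oy]; have [yp|] := eqVneq y p; last by exists y; split=> //;
  exact/eqP.
have [u /rnorm_unit u1] := nonzero_vector hdim; have [r r0 rO] :=
  open_rball oO Oy.
have ru : rnorm ((of_real (r / 2) : K) *: u) = r / 2.
  by rewrite rnormZr ?u1 ?mulr1 // ltW // divr_gt0.
exists (y + (of_real (r / 2) : K) *: u); split.
  by apply: rO; rewrite /rball /= addrAC subrr add0r ru; lra.
rewrite /= yp => /eqP; rewrite -subr_eq0 addrAC subrr add0r -rnorm_eq0 ru.
by rewrite gt_eqF // divr_gt0.
Qed.

(** A nonempty open set stays nonempty and open without one point, so the first [m] orbit points can
    be removed one at a time. *)
Lemma hypercyclic_orbit_tail T x m (O : set X) : infinite_dimensional X ->
  hypercyclic_vector T x -> open O -> O !=set0 ->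
  exists2 n, (m <= n)%N & O (iter n T x).
Proof.
move=> hdim hx; elim: m O => [|m IH] O oO O0.
  by have [y [Oy [n _ ny]]] := hx O O0 oO; exists n => //; rewrite ny.
have [||n mn [On np]] := IH (O `\` [set iter m T x]).
- apply: openI => //; rewrite openC.
  by apply: accessible_closed_set1; exact/hausdorff_accessible/norm_hausdorff.
- exact: open_no_isolated.
exists n => //; rewrite ltn_neqAle mn andbT; apply/eqP => mnE.
by apply: np; rewrite mnE.
Qed.

(** Birkhoff's transitivity criterion. A dense orbit visits [U i] and then, no earlier, [U j];
    conversely, Baire yields a vector whose orbit meets every [U j]. *)
Lemma hypercyclicP T : infinite_dimensional X ->
  hypercyclic T <->
  forall i j, exists n, exists2 x, U i x & U j (iter n T x).
Proof.
move=> hdim; split=> [[x hx] i j|h].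
  have [m _ Um] := hypercyclic_orbit_tail 0 hdim hx (oU i) (U0 i).
  have [n mn Un] := hypercyclic_orbit_tail m hdim hx (oU j) (U0 j).
  by exists (n - m)%N, (iter m T x) => //; rewrite -iterD subnK.
pose F j := [set x | exists2 n, (0 <= n)%N & U j (iter n T x)].
have FP : forall j, open (F j) /\ dense (F j).
  move=> j; split; first by apply: open_exists => // n; exact: iter_continuous.
  by apply: (dense_base Ub) => i; have [n [x Ux Ujx]] := h i j; exists x => //;
    exists n.
have [||x [_ Fx]] := baire_hilbert FP (O := setT).
- by exists 0.
- exact: openT.
exists x; apply: (dense_base Ub) => j; have [n _ Un] := Fx j I.
by exists (iter n T x) => //; exists n.
Qed.

End dynamics.

(** * Dynamics of an operator with a decaying right inverse *)

Section right_inverse_dynamics.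
Context {R : realType} {k : scalars} {X : hilbertType R k}.
Local Notation K := (scalar_field R k).
Implicit Types (x y z : X).
Variables (S : bounded_operator X) (F : X -> X) (L w : R).
Hypothesis kernel_dense : forall x (eps : R), 0 < eps ->
  exists2 z, rnorm (z - x) < eps & exists n, iter n S z = 0.
Hypotheses (L0 : 0 <= L) (w1 : 1 < w).
Hypothesis iterK : forall n y, iter n S (iter n F y) = y.
Hypothesis F_small : forall n y,
  rnorm (iter n.+1 F y) <= L * w^-1 ^+ n * rnorm y.

Lemma kernel_point (O : set X) : open O -> O !=set0 ->
  exists z (r : R) n0, [/\ 0 < r, rball z r `<=` O &
    forall n, (n0 <= n)%N -> iter n S z = 0].
Proof.
move=> oO [x Ox]; have [r r0 rO] := open_rball oO Ox.
have [z zx [n0 zn]] := kernel_dense x r0.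
have [r' r'0 r'O] := open_rball oO (rO _ zx).
exists z, r', n0; split=> // n n0n.
by rewrite -(subnK n0n) iterD zn iter_linear0.
Qed.

(** If a power of [S] kills [z], then for large [n] the vector [z + F^(n+1) y] is close to [z] and
    [S^(n+1)] maps it to [y]. *)
Lemma kernel_transitive (O O' : set X) : open O -> O !=set0 -> O' !=set0 ->
  exists n, exists2 x, O x & O' (iter n S x).
Proof.
move=> oO O0 [y O'y]; have [z [r [n0 [r0 zO zn]]]] := kernel_point oO O0.
have C0 : 0 < L * rnorm y + 1 by rewrite ltr_wpDl // mulr_ge0 ?rnorm_ge0.
have w0 : 0 < w by exact: lt_trans w1.
have q01 : 0 <= w^-1 < 1 by rewrite invr_ge0 invf_lt1 // w1 (ltW w0).
have [n n0n qn] := geometric_small n0 q01 (divr_gt0 r0 C0).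
exists n.+1, (z + iter n.+1 F y); last
  by rewrite iter_linearD iterK zn ?add0r // leqW.
apply: zO; rewrite /rball /= -iterS addrAC subrr add0r.
apply: le_lt_trans (F_small _ _) _; move: qn; rewrite ltr_pdivlMr //.
apply: le_lt_trans; rewrite mulrAC mulrC ler_wpM2l ?lerDl //.
by rewrite exprn_ge0 //; case/andP: q01.
Qed.

(** An orbit that reaches 0 has eventually constant sums [C], so its means are [C / n]. *)
Lemma kernel_small_means (O : set X) l : open O -> O !=set0 ->
  O `&` small_means S l !=set0.
Proof.
move=> oO O0; have [z [r [n0 [r0 zO zn]]]] := kernel_point oO O0.
exists z; split; first by apply: zO; exact: rball_center.
pose C := \sum_(1 <= i < n0.+1) rnorm (iter i S z).
have C0 : 0 <= C by apply: sumr_ge0 => i _; exact: rnorm_ge0.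
pose n := (maxn (maxn n0 l) (Num.truncn (C * l.+1%:R))).+1.
have n0n : (n0 <= n)%N by rewrite leqW // -maxnA leq_maxl.
exists n; first by rewrite leqW // leq_max leq_maxr.
have -> : orbit_mean S z n = n%:R^-1 * C.
  rewrite /orbit_mean (@big_cat_nat _ _ _ n0.+1) //= [X in _ + X](_ : _ = 0)
    ?addr0 // big_nat_cond big1 //.
  by move=> i /andP[/andP[n0i _] _]; rewrite zn ?rnorm0 // ltnW.
rewrite mulrC ltr_pdivrMr ?ltr0n // mulrC ltr_pdivlMr ?ltr0n //.
by apply: lt_le_trans (truncnS_gt _) _; rewrite ler_nat ltnS leq_maxr.
Qed.

(** Add [F^(n+1) y] with [rnorm y = (n + 1) * (l + 1)]: the single term at time [n + 1] lifts the
    mean above [l], while the perturbation is of order [(n + 1) * w^-n]. *)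
Lemma kernel_large_means (O : set X) l : infinite_dimensional X ->
  open O -> O !=set0 -> O `&` large_means S l !=set0.
Proof.
move=> hdim oO O0; have [z [r [n0 [r0 zO zn]]]] := kernel_point oO O0.
have [u /rnorm_unit u1] := nonzero_vector hdim.
have D0 : 0 < L * l.+1%:R + 1 by rewrite ltr_wpDl // mulr_ge0.
have [n jn qn] := linear_geometric_small (maxn n0 l) w1 (divr_gt0 r0 D0).
pose t : R := n.+1%:R * l.+1%:R; pose y := (of_real t : K) *: u.
have t0 : 0 <= t by rewrite mulr_ge0.
have ny : rnorm y = t by rewrite rnormZr // u1 mulr1.
have q0 : 0 <= w^-1 ^+ n by rewrite exprn_ge0 // invr_ge0 ltW //
  (lt_trans _ w1).
exists (z + iter n.+1 F y); split.
  apply: zO; rewrite /rball /= -iterS addrAC subrr add0r.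
  apply: le_lt_trans (F_small _ _) _; move: qn; rewrite ltr_pdivlMr //.
  apply: le_lt_trans; rewrite ny /t.
  have -> : L * w^-1 ^+ n * (n.+1%:R * l.+1%:R) = n.+1%:R * w^-1 ^+ n *
    (L * l.+1%:R).
    by move: (w^-1 ^+ n) => a; ring.
  by rewrite ler_wpM2l ?mulr_ge0 // lerDl.
exists n.+1; first by rewrite leqW // (leq_trans _ jn) // leq_maxr.
rewrite /orbit_mean big_nat_recr //= -!iterS iter_linearD iterK zn ?add0r;
  last first.
  by rewrite leqW // (leq_trans _ jn) // leq_maxl.
rewrite ny mulrDr /t mulKf ?pnatr_eq0 //.
apply: lt_le_trans (_ : l.+1%:R <= _); first by rewrite ltr_nat.
by rewrite lerDr mulr_ge0 ?invr_ge0 // sumr_ge0 // => i _; exact: rnorm_ge0.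
Qed.

End right_inverse_dynamics.

Theorem theorem3p5 (R : realType) (k : scalars) (X : hilbertType R k)
    (hdim : infinite_dimensional X) (hsep : separable X)
    (M : R) (hM : 1 < M) :
  let A := [set T : set_type (operator_ball X M) |
             hypercyclic (\val T) /\
             residual [set x : X | absolutely_mean_irregular (\val T) x]] in
  Gdelta A /\ dense A.
Proof.
move=> A; have M0 : 0 <= M by rewrite ltW // (lt_trans ltr01).
have [U [oU U0 Ub]] := countable_base hsep.
(* Both criteria are merged into conditions indexed by the countable set of triples [(i, j, l)]. *)
have AP T : A T <-> forall p : nat * nat * nat,
    [/\ exists n, exists2 x, U p.1.1 x & U p.1.2 (iter n (\val T) x),
      U p.1.1 `&` small_means (\val T) p.2 !=set0 &
      U p.1.1 `&` large_means (\val T) p.2 !=set0].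
  split=> [[/(hypercyclicP oU U0 Ub _ hdim) hT /(residual_meanP oU U0 Ub)
    rT]|h].
    by move=> [[i j] l]; split=> //=; case: (rT i l).
  split; first by apply/(hypercyclicP oU U0 Ub _ hdim) => i j; case:
    (h (i, j, 0%N)).
  by apply/(residual_meanP oU U0 Ub) => i l; case: (h (i, 0%N, l)).
have mean_cont x n : continuous
    (fun T : set_type (operator_ball X M) => orbit_mean (\val T) x n).
  by apply: mean_continuous => i; exact: iter_ball_continuous.
split.
  pose F p := [set T : set_type (operator_ball X M) |
    [/\ exists n, exists2 x, U p.1.1 x & U p.1.2 (iter n (\val T) x),
      U p.1.1 `&` small_means (\val T) p.2 !=set0 &
      U p.1.1 `&` large_means (\val T) p.2 !=set0]].
  (* The witnessing vectors and times stay fixed while the operator varies near [T]. *)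
  have oF p : open (F p).
    rewrite openE => T [[n [x Ux Uy]] [x1 [Ux1 [n1 ln1 m1]]]
      [x2 [Ux2 [n2 ln2 m2]]]].
    have /(@iter_ball_continuous _ _ _ M n x M0 T) h :
      nbhs (iter n (\val T) x) (U p.1.2).
      exact: open_nbhs_nbhs.
    have /(mean_cont x1 n1 T) h1 :
      nbhs (orbit_mean (\val T) x1 n1) [set r | r < p.2.+1%:R^-1].
      by apply: open_nbhs_nbhs; split=> //; exact: open_lt.
    have /(mean_cont x2 n2 T) h2 :
      nbhs (orbit_mean (\val T) x2 n2) [set r | p.2%:R < r].
      by apply: open_nbhs_nbhs; split=> //; exact: open_gt.
    have FT := nbhs_filter T.
    have h12 := @filterI _ _ FT _ _ (h1 : nbhs T _) (h2 : nbhs T _).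
    apply: (@filterS _ _ FT _ _ _ (@filterI _ _ FT _ _ (h : nbhs T _) h12)) =>
      S [hS [h1S h2S]]; split.
    - by exists n, x.
    - by exists x1; split=> //; exists n1.
    - by exists x2; split=> //; exists n2.
  (* An integer that codes no triple repeats the condition of [(0, 0, 0)]. *)
  exists (fun i => F (odflt (0, 0, 0)%N (unpickle i))) => //.
  apply/seteqP; split=> [T /AP AT i _|T h]; first exact: AT.
  by apply/AP => p; have := h (pickle p) I; rewrite pickleK.
(* [O] is the trace on the ball of a strong* open set [V], so it suffices to perturb [T] within a
   basic neighbourhood contained in [V]. *)
move=> O [T OT] [V oV VO].
have VT : V (\val T) by have := OT; rewrite -VO.
have : nbhs (\val T) V by apply: open_nbhs_nbhs.
move=> [s [eps [e0 sV]]].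
have TM : forall x, rnorm (\val T x) <= M * rnorm x.
  exact/(operator_ballP _ M0)/set_mem/(valP T).
have [S [SM Sclose kerS [F [L [w [L0 w1 FK Fsmall]]]]]] :=
  perturbation s hdim hsep hM e0 TM.
have SB : S \in operator_ball X M by apply/mem_set/(operator_ballP _ M0).
exists (exist _ S SB); split; first by rewrite -VO; apply: sV.
apply/AP => -[[i j] l]; split=> /=.
- exact: (kernel_transitive kerS L0 w1 FK Fsmall).
- exact: (kernel_small_means kerS).
- exact: (kernel_large_means kerS L0 w1 FK Fsmall).
Qed.
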